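(* Let $\alpha\in(0,1)$. Assume that $(X_i,\mathcal{F}_i)_{i\ge 1}$ is a sequence of supermartingale differences satisfying $$\sup_{i\ge 1} E\exp\{|X_i|^{\frac{2\alpha}{1-\alpha}}\}\le C_1$$ for some constant $C_1\in(0,\infty)$, and let $S_k=\sum_{i=1}^k X_i$. Then, for all $x>0$ and all integers $n\ge 1$, $$P\Big(\max_{1\le k\le n}S_k\ge nx\Big)\le C(\alpha,x)\exp\Big\{-\Big(\frac{x}{4}\Big)^{2\alpha}n^{\alpha}\Big\},$$ where $$C(\alpha,x)=2+35\,C_1\left(\frac{1}{x^{2\alpha}16^{1-\alpha}}+\frac{1}{x^2}\Big(\frac{3(1-\alpha)}{2\alpha}\Big)^{\frac{1-\alpha}{\alpha}}\right)$$ does not depend on $n$. In particular, with $x=1$, $$P\Big(\max_{1\le k\le n}S_k\ge n\Big)=O\Big(\exp\{-\tfrac{1}{16}n^{\alpha}\}\Big),\qquad n\to\infty.$$ Moreover, the power $\alpha$ in the last bound is optimal even for the class of stationary martingale differences, in the following sense: for each $\alpha\in(0,1)$, there exists a stationary sequence of martingale differences $(\widehat{X}_i,\mathcal{F}_i)_{i\ge 1}$ satisfying $E\exp\{|\widehat{X}_1|^{\frac{2\alpha}{1-\alpha}}\}<\infty$ and, with $\widehat{S}_k=\sum_{i=1}^k\widehat{X}_i$, $$P\Big(\max_{1\le k\le n}\widehat{S}_k\ge n\Big)\ge\exp\{-3n^{\alpha}\}$$ for all $n$ large enough.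
   Context: A sequence of supermartingale differences (resp. martingale differences) $(X_i,\mathcal{F}_i)_{i\ge1}$ is a sequence of integrable real random variables on a probability space with a filtration $\mathcal{F}_0\subseteq\mathcal{F}_1\subseteq\mathcal{F}_2\subseteq\cdots$ such that each $X_i$ is $\mathcal{F}_i$-measurable and $E(X_i|\mathcal{F}_{i-1})\le 0$ (resp. $=0$) almost surely for all $i\ge1$; $\mathcal{F}_0$ is not required to be trivial. For two functions $f$ and $g$, $f(n)=O(g(n))$ means that there exists a constant $C>0$ such that $|f(n)|\le C|g(n)|$ for all $n\ge1$. *)

(* Defs.v *)
From HB Require Import structures.
From mathcomp Require Import all_boot all_order all_algebra.
From mathcomp Require Import all_classical all_reals all_analysis.
Set Implicit Arguments.
Unset Strict Implicit.
Unset Printing Implicit Defensive.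
Import Order.TTheory GRing.Theory Num.Theory.
Import numFieldNormedType.Exports.

Local Open Scope classical_set_scope.
Local Open Scope ring_scope.

(* A sub-sigma-algebra of T is a set G of subsets of T.  Sequences of random
   variables are functions nat -> T -> R used at indices i >= 1 only; the value
   at index 0 is never constrained. *)

Definition measurable_wrt (R : realType) (d : measure_display)
    (T : measurableType d) (G : set (set T)) (f : T -> R) : Prop :=
  forall B : set R, measurable B -> G (f @^-1` B).

Definition filtration (d : measure_display) (T : measurableType d)
    (F : nat -> set (set T)) : Prop :=
  [/\ forall i, sigma_algebra setT (F i),
      forall i, F i `<=` measurable &
      forall i, F i `<=` F i.+1].

(* Y is a version of E(X | G). *)
Definition is_cond_expectation (R : realType) (d : measure_display)
    (T : measurableType d) (P : probability T R) (G : set (set T))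
    (X Y : T -> R) : Prop :=
  [/\ measurable_wrt G Y,
      P.-integrable setT (EFin \o Y) &
      forall A, G A ->
        (\int[P]_(w in A) (Y w)%:E = \int[P]_(w in A) (X w)%:E)%E].

Definition adapted_integrable (R : realType) (d : measure_display)
    (T : measurableType d) (P : probability T R)
    (F : nat -> set (set T)) (X : nat -> T -> R) : Prop :=
  forall i, (1 <= i)%N ->
    measurable_wrt (F i) (X i) /\ P.-integrable setT (EFin \o X i).

(* The conditional expectation of an integrable variable exists and is unique
   up to P-null sets, so the choice of the version Y below is immaterial. *)
Definition supermartingale_differences (R : realType) (d : measure_display)
    (T : measurableType d) (P : probability T R)
    (F : nat -> set (set T)) (X : nat -> T -> R) : Prop :=
  [/\ filtration F,
      adapted_integrable P F X &
      forall i, (1 <= i)%N -> exists Y : T -> R,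
        is_cond_expectation P (F i.-1) (X i) Y /\
        {ae P, forall w, Y w <= 0}].

Definition martingale_differences (R : realType) (d : measure_display)
    (T : measurableType d) (P : probability T R)
    (F : nat -> set (set T)) (X : nat -> T -> R) : Prop :=
  [/\ filtration F,
      adapted_integrable P F X &
      forall i, (1 <= i)%N -> exists Y : T -> R,
        is_cond_expectation P (F i.-1) (X i) Y /\
        {ae P, forall w, Y w = 0}].

(* Strict stationarity: (X_1, ..., X_m) and (X_(1+k), ..., X_(m+k)) have the
   same law on R^m, for all m and k. *)
Definition stationary (R : realType) (d : measure_display)
    (T : measurableType d) (P : probability T R) (X : nat -> T -> R) : Prop :=
  forall (m k : nat) (B : set (m.-tuple R)), measurable B ->
    pushforward P (fun w => [tuple X (i.+1 + k)%N w | i < m]) B =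
    pushforward P (fun w => [tuple X i.+1 w | i < m]) B.

Definition partial_sum (R : realType) (T : Type) (X : nat -> T -> R)
    (k : nat) (w : T) : R :=
  \sum_(1 <= i < k.+1) X i w.

(* The maximum of S_1, ..., S_n, meaningful for n >= 1; S_1 as the initial
   value of the iteration does not affect it. *)
Definition max_partial_sum (R : realType) (T : Type) (X : nat -> T -> R)
    (n : nat) (w : T) : R :=
  \big[Num.max/partial_sum X 1 w]_(1 <= k < n.+1) partial_sum X k w.

Definition is_bigO (R : realType) (f g : nat -> R) : Prop :=
  exists C : R, 0 < C /\ forall n : nat, (1 <= n)%N -> `|f n| <= C * `|g n|.

Definition bound_const (R : realType) (C1 alpha x : R) : R :=
  2 + 35 * C1 *
    (1 / (x `^ (2 * alpha) * 16 `^ (1 - alpha))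
     + 1 / x ^+ 2
       * (3 * (1 - alpha) / (2 * alpha)) `^ ((1 - alpha) / alpha)).

(* Main.v *)
Require Import Defs.
From HB Require Import structures.
From mathcomp Require Import all_boot all_order all_algebra.
From mathcomp Require Import ring lra.
From mathcomp Require Import all_classical all_reals all_analysis.
From mathcomp Require Import measurable_realfun.
Import Order.TTheory GRing.Theory Num.Theory.
Import numFieldNormedType.Exports.

(** The upper bound. Put p = 2 alpha / (1 - alpha), fix a level u, and split each
    increment into X' = X 1{|X| <= u} and X'' = X - X'. Neither part inherits the
    nonpositive drift of X, but a bounded predictable term v can be moved from one
    to the other so that both X' + v and X'' - v have it
    ([truncation_compensator]). The maximum of the partial sums reaches n x only if
    one of the two parts reaches n x / 2. For the bounded part this has probability
    at most exp(- n (x/4)^2 / u^2), by an inequality of Azuma type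
    ([supermartingale_azuma]). For the other part Kolmogorov's inequality
    ([supermartingale_kolmogorov]) bounds it by the sum of n second moments, each of
    order u^2 exp(- u^p) by [sqr_le_powR_expR] and the exponential moment, divided
    by (n x / 2)^2. The level u is the one at which both exponents are equal to
    (x/4)^(2 alpha) n^alpha ([trunc_level_rate], [trunc_level_powR]). Then u^2 is of
    order n^(1 - alpha), so that no power of n is left in front of the exponential
    ([bound_const_ge]).

    Both inequalities come from one maximal inequality for nonnegative potentials
    ([potential_maximal_inequality]). The drift conditions are stated as integrals
    over the events of the past; [Rintegral_mul_le0] passes from events to bounded
    weights, which is all that is used of conditioning besides the existence of
    conditional expectations ([cond_expectation_exists]).

    Optimality. Let y be a random scale known at time 0, let e_1, e_2, ... be fair
    signs independent of y, and put X_i = y e_i. The scale takes the value y_m with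
    probability 2^-(m+1), where y_m^p = (2/3) m ln 2, so that the exponential moment
    is a convergent geometric series ([step_exp_moment]). At the price of
    exp(- 3/2 n^alpha) the scale exceeds n^((1 - alpha)/2); it is then enough that
    the sign walk exceeds n^((1 + alpha)/2) at time n, and this has probability at
    least exp(- 49/36 n^alpha) / 2 by an elementary exponential tilt
    ([coin_tail_lower]). Since 3/2 + 49/36 < 3, the constants are absorbed for
    large n ([coin_walk_max_lower]).

    The underlying space consists of the pairs (m, sequence of coins), with the
    sigma-algebra generated by the cylinders; its probability is the image of the
    Lebesgue measure of ]0, 1[ under binary expansion, m being the number of leading
    zeros ([coin_measure_exists]). The martingale property and stationarity express
    the invariance of this measure under the flip of one coin and under the shift of
    the coin sequence, and both invariances can be read off the cylinders. *)

Local Open Scope classical_set_scope.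
Local Open Scope ring_scope.

Set Implicit Arguments.
Unset Strict Implicit.
Unset Printing Implicit Defensive.

(** * Bounds on the hyperbolic cosine *)

Section Cosh.
Context {R : realType}.
Implicit Types a x y : R.

Lemma nondecreasing_ge0 (f f' : R -> R) : (forall x : R, is_derive x 1 f (f' x)) ->
  (forall x, 0 <= x -> 0 <= f' x) -> forall x y, 0 <= x -> x <= y -> f x <= f y.
Proof.
move=> df f'0 x y x0 xy.
apply: (@ger0_derive1_le_cc R f x y) => //.
- move=> z; rewrite in_itv/= => /andP[xz _].
  rewrite derive1E; have [_ ->] := df z; rewrite f'0// (le_trans x0)// ltW//.
- by apply: derivable_within_continuous => z _; have [h _] := df z; exact: h.
- by rewrite in_itv/= lexx xy.
- by rewrite in_itv/= lexx xy.
Qed.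

(** For x >= 0 the function cosh x exp(- x^2 / 2) is nonincreasing, because
    sinh x <= x cosh x; the latter holds since x cosh x - sinh x has derivative
    x sinh x. *)
Lemma cosh_le_expR_half_sqr a : (expR a + expR (- a)) / 2 <= expR (a ^+ 2 / 2).
Proof.
wlog a0 : a / 0 <= a.
  move=> H; have [/H//|a0] := leP 0 a.
  by have := H (- a); rewrite opprK sqrrN addrC; apply; rewrite oppr_ge0 ltW.
have sinh_le x : 0 <= x -> expR x - expR (- x) <= x * (expR x + expR (- x)).
  move=> x0.
  pose f (x : R) : R := x * (expR x + expR (- x)) - (expR x - expR (- x)).
  have df (z : R) : is_derive z 1 f (z * (expR z - expR (- z))).
    rewrite /f; apply: is_derive_eq; rewrite /GRing.scale/=; ring.
  have := nondecreasing_ge0 df _ (lexx 0) x0.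
  rewrite /f mul0r oppr0 expR0 subrr subrr subr_ge0; apply=> z z0.
  by rewrite mulr_ge0// subr_ge0 ler_expR; lra.
pose g (x : R) : R := - ((expR x + expR (- x)) * expR (- (x ^+ 2 / 2))).
have dg (z : R) : is_derive z 1 g
    ((z * (expR z + expR (- z)) - (expR z - expR (- z))) * expR (- (z ^+ 2 / 2))).
  rewrite /g; apply: is_derive_eq; rewrite /GRing.scale/=; by field.
have := nondecreasing_ge0 dg _ (lexx 0) a0.
rewrite /g oppr0 expR0 expr0n/= mul0r oppr0 expR0 mulr1 lerN2 => H.
have : (expR a + expR (- a)) * expR (- (a ^+ 2 / 2)) <= 1 + 1.
  by apply: H => z z0; rewrite mulr_ge0 ?expR_ge0// subr_ge0 sinh_le.
rewrite [expR (- (a ^+ 2 / 2))]expRN ler_pdivrMr ?expR_gt0//; lra.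
Qed.

(** Two integrations of cosh >= 1. *)
Lemma cosh_ge_quadratic a : 1 + a ^+ 2 / 2 <= (expR a + expR (- a)) / 2.
Proof.
wlog a0 : a / 0 <= a.
  move=> H; have [/H//|a0] := leP 0 a.
  by have := H (- a); rewrite opprK sqrrN [X in _ <= X / _]addrC; apply; rewrite oppr_ge0 ltW.
have sinh_ge x : 0 <= x -> 2 * x <= expR x - expR (- x).
  move=> x0.
  pose f (x : R) : R := expR x - expR (- x) - 2 * x.
  have df (z : R) : is_derive z 1 f (expR z + expR (- z) - 2).
    rewrite /f; apply: is_derive_eq; rewrite /GRing.scale/=; ring.
  have := nondecreasing_ge0 df _ (lexx 0) x0.
  rewrite /f oppr0 expR0 mulr0 subrr subr0 subr_ge0; apply=> z z0.
  by have := expR_ge1Dx z; have := expR_ge1Dx (- z); lra.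
pose g (x : R) : R := expR x + expR (- x) - x ^+ 2.
have dg (z : R) : is_derive z 1 g (expR z - expR (- z) - 2 * z).
  rewrite /g; apply: is_derive_eq; rewrite /GRing.scale/=; ring.
have := nondecreasing_ge0 dg _ (lexx 0) a0.
rewrite /g oppr0 expR0 expr0n/= subr0 => H.
have : 1 + 1 <= expR a + expR (- a) - a ^+ 2.
  by apply: H => z z0; rewrite subr_ge0 sinh_ge.
lra.
Qed.

(** From 1 + v >= exp(v / (1 + v)) with v = a^2 / 2. The factor 31/64 falls short of
    the limit value 1/2 by little enough for [coin_tail_lower]. *)
Lemma cosh_ge_expR a : a ^+ 2 <= 2 / 31 ->
  expR (31 / 64 * a ^+ 2) <= (expR a + expR (- a)) / 2.
Proof.
move=> a31; apply: le_trans (cosh_ge_quadratic a).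
set v := a ^+ 2 / 2; have v0 : 0 <= v by rewrite /v divr_ge0// sqr_ge0.
have v31 : v <= 1 / 31 by rewrite /v; lra.
have v1 : 0 < 1 + v by lra.
apply: (@le_trans _ _ (expR (v / (1 + v)))).
  rewrite ler_expR ler_pdivlMr// (_ : 31 / 64 * a ^+ 2 = 31 / 32 * v); last by rewrite /v; field.
  nra.
have -> : v / (1 + v) = - (- (v / (1 + v))) by rewrite opprK.
rewrite expRN -[leRHS]invrK lef_pV2 ?posrE ?expR_gt0 ?invr_gt0//.
apply: le_trans (expR_ge1Dx _).
by rewrite le_eqVlt; apply/orP; left; apply/eqP; field; apply/eqP; lra.
Qed.
End Cosh.

(** * Real inequalities and the truncation level *)

Section RealInequalities.
Context {R : realType}.
Implicit Types a x y z t u p q v : R.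

(** The left-hand side is E exp(a D), where D is the centred variable with values
    v + 1 and v - 1. If D' is an independent copy, Jensen's inequality gives
    E exp(- a D') >= 1, and E exp(a (D - D')) is at most cosh^2 a for every v. *)
Lemma two_point_mgf_le a v : -1 <= v <= 1 ->
  expR (a * v) * ((expR a + expR (- a)) / 2 - v * ((expR a - expR (- a)) / 2))
    <= expR (a ^+ 2).
Proof.
move=> /andP[v1 v2].
pose q := (1 - v) / 2.
have q0 : 0 <= q by rewrite /q; lra.
have q1 : 0 <= 1 - q by rewrite /q; lra.
set E1 := expR (a * (v + 1)); set E2 := expR (a * (v - 1)).
have -> : expR (a * v) * ((expR a + expR (- a)) / 2
     - v * ((expR a - expR (- a)) / 2)) = q * E1 + (1 - q) * E2.
  rewrite /E1 /E2 !mulrDr !expRD mulr1 mulrN1 /q.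
  by field.
have l1 : 1 + - (a * (v + 1)) <= expR (- (a * (v + 1))) by exact: expR_ge1Dx.
have l2 : 1 + - (a * (v - 1)) <= expR (- (a * (v - 1))) by exact: expR_ge1Dx.
have E10 : 0 < E1 by exact: expR_gt0.
have E20 : 0 < E2 by exact: expR_gt0.
(* J1 and J2 are the values of exp(- a D'). *)
set J1 := expR (- (a * (v + 1))) in l1; set J2 := expR (- (a * (v - 1))) in l2.
have hJ : 1 <= q * J1 + (1 - q) * J2.
  have e1 : 1 = q * (1 + - (a * (v + 1))) + (1 - q) * (1 + - (a * (v - 1))).
    by rewrite /q; field.
  by rewrite [leLHS]e1; apply: lerD; rewrite ler_wpM2l.
have E1J1 : E1 * J1 = 1 by rewrite /E1 /J1 -expRD subrr expR0.
have E2J2 : E2 * J2 = 1 by rewrite /E2 /J2 -expRD subrr expR0.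
have E1J2 : E1 * J2 = expR a ^+ 2.
  by rewrite /E1 /J2 -expRD expr2 -expRD; congr expR; ring.
have E2J1 : E2 * J1 = expR (- a) ^+ 2.
  by rewrite /E2 /J1 -expRD expr2 -expRD; congr expR; ring.
have Eaa : expR a * expR (- a) = 1 by rewrite -expRD subrr expR0.
have key : (q * E1 + (1 - q) * E2) * (q * J1 + (1 - q) * J2) <=
   ((expR a + expR (- a)) / 2) ^+ 2.
  have -> : (q * E1 + (1 - q) * E2) * (q * J1 + (1 - q) * J2) =
     q ^+ 2 * (E1 * J1) + (1 - q)^+2 * (E2 * J2)
     + q * (1 - q) * (E1 * J2 + E2 * J1) by ring.
  rewrite E1J1 E2J2 E1J2 E2J1.
  set z := expR a in Eaa *; set z' := expR (- a) in Eaa *.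
  have -> : ((z + z')/2)^+2 = (z ^+ 2 + z' ^+ 2 + 2 * (z * z')) / 4 by field.
  rewrite Eaa.
  have zz : 2 <= z ^+ 2 + z' ^+ 2 by have := sqr_ge0 (z - z'); nra.
  have qq : q * (1 - q) <= 1 / 4 by have := sqr_ge0 (q - 1/2); nra.
  nra.
have base : 0 <= q * E1 + (1 - q) * E2 by rewrite addr_ge0 // mulr_ge0 // ltW.
have : q * E1 + (1 - q) * E2 <= (q * E1 + (1 - q) * E2) * (q * J1 + (1 - q) * J2).
  by rewrite ler_peMr.
move/le_trans; apply; apply: (le_trans key).
have -> : expR (a ^+ 2) = expR (a ^+ 2 / 2) ^+ 2.
  by rewrite [RHS]expr2 -expRD; congr expR; field.
by rewrite ler_pXn2r ?nnegrE ?expR_ge0 //; exact: cosh_le_expR_half_sqr.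
Qed.

(** Convexity on [-u, u], as the average of the tangent inequalities from y to the
    two end points. *)
Lemma expR_le_chord (c y u : R) : 0 < u -> - u <= y <= u ->
  expR (c * y) <= (expR (c * u) + expR (- (c * u))) / 2
               + y / u * ((expR (c * u) - expR (- (c * u))) / 2).
Proof.
move=> u0 /andP[y1 y2].
pose tt := (1 + y / u) / 2.
have yu1 : -1 <= y / u by rewrite ler_pdivlMr // mulN1r.
have yu2 : y / u <= 1 by rewrite ler_pdivrMr // mul1r.
have t0 : 0 <= tt by rewrite /tt; lra.
have t1 : tt <= 1 by rewrite /tt; lra.
have tangent z : expR (c * y) * (1 + (c * z - c * y)) <= expR (c * z).
  have := expR_ge1Dx (c * z - c * y); move/(ler_wpM2l (expR_ge0 (c * y))).
  by rewrite -expRD (_ : c * y + (c * z - c * y) = c * z)//; ring.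
have h1 := tangent u; have h2 := tangent (- u).
rewrite mulrN in h2.
have -> : (expR (c * u) + expR (- (c * u))) / 2
               + y / u * ((expR (c * u) - expR (- (c * u))) / 2) =
   tt * expR (c * u) + (1 - tt) * expR (- (c * u)).
  by rewrite /tt; field; apply/eqP; lra.
have : tt * (expR (c * y) * (1 + (c * u - c * y))) +
   (1 - tt) * (expR (c * y) * (1 + (- (c * u) - c * y))) <=
   tt * expR (c * u) + (1 - tt) * expR (- (c * u)).
  by apply: lerD; rewrite ler_wpM2l // subr_ge0.
apply: le_trans; rewrite le_eqVlt; apply/orP; left; apply/eqP.
rewrite /tt; field; apply/eqP; lra.
Qed.

(** The function x^q exp(- x) increases up to q and decreases afterwards. Beyond y it
    is therefore at most its value at y if y >= q, and at most its maximum
    q^q exp(- q) otherwise. *)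
Lemma powR_expR_le q x y : 0 < q -> 0 < y -> y <= x ->
  x `^ q * expR (- x) <= (y `^ q + q `^ q) * expR (- y).
Proof.
move=> q0 y0 yx; have x0 : 0 < x by lra.
suff : x `^ q <= (y `^ q + q `^ q) * expR (x - y).
  rewrite -(ler_pM2r (expR_gt0 (- x))) -mulrA -expRD.
  by rewrite (_ : x - y - x = - y) //; ring.
(* 1 + z <= exp z at z = (x - m) / m, to be used with m = max(y, q) *)
have main m : 0 < m -> x `^ q <= m `^ q * expR (q * ((x - m) / m)).
  move=> m0; rewrite [q * (_ / m)]mulrC [expR _]expRM -powRM ?expR_ge0 ?(ltW m0)//.
  apply: ge0_ler_powR; rewrite ?nnegrE ?(ltW q0) ?(ltW x0) //.
    by rewrite mulr_ge0 ?expR_ge0 ?(ltW m0).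
  have := expR_ge1Dx ((x - m) / m); move/(ler_wpM2l (ltW m0)); apply: le_trans.
  by rewrite le_eqVlt; apply/orP; left; apply/eqP; field; apply/eqP; lra.
have [qy|yq] := lerP q y.
  apply: (le_trans (main _ y0)); apply: ler_pM; rewrite ?powR_ge0 ?expR_ge0//.
    by rewrite lerDl powR_ge0.
  rewrite ler_expR mulrA ler_pdivrMr // [q * _]mulrC ler_wpM2l //; lra.
apply: (le_trans (main _ q0)); apply: ler_pM; rewrite ?powR_ge0 ?expR_ge0//.
  by rewrite lerDr powR_ge0.
rewrite ler_expR (_ : q * _ = x - q); first by lra.
by field; apply/eqP; lra.
Qed.

Lemma sqr_le_powR_expR (p u t : R) : 0 < p -> 0 < u -> u <= t ->
  t ^+ 2 <= (u ^+ 2 + (2 / p) `^ (2 / p)) * expR (- (u `^ p)) * expR (t `^ p).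
Proof.
move=> p0 u0 ut; have t0 : 0 < t by exact: lt_le_trans ut.
have q0 : 0 < 2 / p by rewrite divr_gt0.
have := @powR_expR_le (2 / p) (t `^ p) (u `^ p) q0 (powR_gt0 _ u0).
rewrite ge0_ler_powR ?nnegrE ?(ltW p0) ?(ltW u0) ?(ltW t0)// => /(_ isT).
rewrite -!powRrM (_ : p * (2 / p) = 2%:R); last by field; apply/eqP; lra.
rewrite !powR_mulrn ?(ltW u0) ?(ltW t0)// => h.
by rewrite -ler_pdivrMr ?expR_gt0// -expRN.
Qed.

Lemma powR_expRln (a b : R) : 0 < a -> a `^ b = expR (b * ln a).
Proof. by move=> a0; rewrite /powR gt_eqF. Qed.

Section TruncationLevel.
Variables (alpha z N : R).
Hypotheses (alpha0 : 0 < alpha) (alpha1 : alpha < 1) (z0 : 0 < z) (N0 : 0 < N).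

(** The solution u of N z^2 / u^2 = u^p with p = 2 alpha / (1 - alpha). *)
Definition trunc_level : R := z `^ (1 - alpha) * N `^ ((1 - alpha) / 2).

Lemma trunc_level_gt0 : 0 < trunc_level.
Proof. by rewrite mulr_gt0 ?powR_gt0. Qed.

Lemma trunc_levelE :
  trunc_level = expR ((1 - alpha) * ln z + (1 - alpha) / 2 * ln N).
Proof. by rewrite /trunc_level !powR_expRln// expRD. Qed.

Lemma trunc_level_powR :
  trunc_level `^ (2 * alpha / (1 - alpha)) = z `^ (2 * alpha) * N `^ alpha.
Proof.
rewrite powR_expRln ?trunc_level_gt0// trunc_levelE expRK !powR_expRln// -expRD.
by congr expR; field; rewrite subr_eq0 gt_eqF.
Qed.

Lemma trunc_level_sqr :
  trunc_level ^+ 2 = z `^ (2 * (1 - alpha)) * N `^ (1 - alpha).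
Proof.
rewrite trunc_levelE expr2 -expRD !powR_expRln// -expRD.
by congr expR; field.
Qed.

Lemma trunc_level_rate :
  N * z ^+ 2 / trunc_level ^+ 2 = z `^ (2 * alpha) * N `^ alpha.
Proof.
rewrite trunc_levelE !expr2 -expRD -expRN !powR_expRln//.
rewrite -[X in X * (_ * _) * _](lnK (x := N)) ?posrE//.
rewrite -[X in _ * (X * X) * _](lnK (x := z)) ?posrE//.
rewrite -!expRD; congr expR; by field.
Qed.

End TruncationLevel.

(** The summand 1 stands for the bounded part of the increments and the other one for
    the tail. As u^2 is of order N^(1 - alpha), the latter is nonincreasing in N, and
    its value at N = 1 is compared with the constant. *)
Lemma bound_const_ge (alpha x N C1 : R) : 0 < alpha -> alpha < 1 -> 0 < x -> 1 <= N ->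
  0 < C1 ->
  1 + N * (C1 * (trunc_level alpha (x / 4) N ^+ 2
         + (2 / (2 * alpha / (1 - alpha))) `^ (2 / (2 * alpha / (1 - alpha)))))
      / (N * (2 * (x / 4))) ^+ 2
  <= bound_const C1 alpha x.
Proof.
move=> a0 a1 x0 N1 C0; rewrite /bound_const.
have N0 : 0 < N by lra.
have z0 : 0 < x / 4 by rewrite divr_gt0.
have e1 : 2 / (2 * alpha / (1 - alpha)) = (1 - alpha) / alpha.
  by field; apply/andP; split; apply/eqP; lra.
rewrite !e1; set b := _ `^ ((1 - alpha) / alpha).
set b' := (3 * (1 - alpha) / (2 * alpha)) `^ ((1 - alpha) / alpha).
have bb' : b <= b'.
  rewrite /b /b' ge0_ler_powR ?nnegrE.
  - by [].
  - by rewrite divr_ge0//; lra.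
  - by rewrite divr_ge0//; lra.
  - by rewrite divr_ge0//; lra.
  rewrite (_ : 3 * (1 - alpha) / (2 * alpha) = 3 / 2 * ((1 - alpha) / alpha)).
    have : 0 <= (1 - alpha) / alpha by rewrite divr_ge0//; lra.
    lra.
  by field; apply/eqP; lra.
have b0 : 0 <= b by exact: powR_ge0.
set k1 := 1 / (x `^ (2 * alpha) * 16 `^ (1 - alpha)).
have k1E : trunc_level alpha (x / 4) N ^+ 2 = N `^ (1 - alpha) * (x ^+ 2 * k1).
  rewrite trunc_level_sqr// mulrC; congr (_ * _).
  rewrite /k1 (_ : (16 : R) = 4 * 4); last by ring.
  have -> : x ^+ 2 = x * x by rewrite expr2.
  have x4 : ln (x / 4) = ln x - ln 4 by rewrite ln_div ?posrE.
  rewrite -[X in X * X * _](lnK (x := x)) ?posrE//.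
  rewrite !powR_expRln// x4 lnM ?posrE// div1r invfM -!expRN -!expRD.
  by congr expR; ring.
have k10 : 0 <= k1 by rewrite divr_ge0// mulr_ge0 ?powR_ge0.
have NN : N `^ (1 - alpha) <= N by apply: ler1_powR => //; lra.
have -> : N * (C1 * (trunc_level alpha (x / 4) N ^+ 2 + b)) / (N * (2 * (x / 4))) ^+ 2
   = 4 * C1 * (N `^ (1 - alpha) / N * k1 + b / x ^+ 2 / N).
  by rewrite k1E; field; apply/andP; split; apply/eqP; lra.
have h1 : N `^ (1 - alpha) / N * k1 <= k1.
  by rewrite ler_piMl// ler_pdivrMr// mul1r.
have h2 : b / x ^+ 2 / N <= 1 / x ^+ 2 * b'.
  have x2 : 0 < x ^+ 2 by rewrite exprn_gt0.
  rewrite ler_pdivrMr// [1 / _ * _]mulrC div1r.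
  apply: (@le_trans _ _ (b' / x ^+ 2)); first by rewrite ler_pM2r ?invr_gt0.
  by rewrite ler_peMr// mulr_ge0 ?invr_ge0 ?(ltW x2)//; exact: le_trans bb'.
have h0 : 0 <= k1 + 1 / x ^+ 2 * b'.
  by rewrite addr_ge0// mulr_ge0 ?divr_ge0 ?sqr_ge0//; exact: le_trans bb'.
have : C1 * (N `^ (1 - alpha) / N * k1 + b / x ^+ 2 / N) <= C1 * (k1 + 1 / x ^+ 2 * b').
  by rewrite ler_pM2l// lerD.
have : 0 <= C1 * (k1 + 1 / x ^+ 2 * b') by rewrite mulr_ge0// ltW.
rewrite -!mulrA; lra.
Qed.
End RealInequalities.

(** * Conditional expectation and the pull-out property *)

Section Preliminaries.
Context {R : realType} {d : measure_display} {T : measurableType d}.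
Variable P : probability T R.

Lemma bounded_integrable (f : T -> R) (c : R) :
  measurable_fun setT f -> (forall x, `|f x| <= c) -> P.-integrable setT (EFin \o f).
Proof.
move=> mf fc; apply: measurable_bounded_integrable => //.
  by rewrite (le_lt_trans (probability_le1 _ _))// ltry.
by exists c; split; [exact: num_real|move=> M cM x _; exact: le_trans (fc x) (ltW cM)].
Qed.

Lemma measurable_ge_set (f : T -> R) (y : R) :
  measurable_fun setT f -> measurable [set x | y <= f x].
Proof.
move=> mf; have := mf measurableT _ (measurable_itv `[y, +oo[).
by rewrite setTI; congr measurable; apply/seteqP; split=> x /=; rewrite in_itv/= andbT.
Qed.

Lemma measurable_some_ge (S : nat -> T -> R) (y : R) (n : nat) :
  (forall k, measurable_fun setT (S k)) ->
  measurable [set x | exists2 k : nat, (k <= n)%N & y <= S k x].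
Proof.
move=> mS; rewrite (_ : [set x | _] =
    \bigcup_(k in [set k | (k <= n)%N]) [set x | y <= S k x]).
  by apply: bigcup_measurable => k _; exact: measurable_ge_set.
by apply/seteqP; split=> x /= [k ? ?]; exists k.
Qed.

End Preliminaries.

Section SubSigma.
Context {R : realType} {d : measure_display} {T : measurableType d}.
Variable (P : probability T R).
Variable (G : set (set T)).
Hypothesis (sG : sigma_algebra setT G) (mG : G `<=` measurable).

Local Notation TG := (g_sigma_algebraType G).

Lemma measurable_subsigma (A : set T) : (measurable : set (set TG)) A <-> G A.
Proof. by rewrite measurable_g_measurableTypeE. Qed.

Lemma measurable_wrtP (f : T -> R) :
  measurable_wrt G f <-> measurable_fun setT (f : TG -> R).
Proof.
split=> [h _ B mB|h B mB].
  by rewrite setTI; apply/measurable_subsigma/h.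
by apply/measurable_subsigma; rewrite -[X in measurable X]setTI; exact: h.
Qed.

Lemma measurable_wrt_measurable (f : T -> R) :
  measurable_wrt G f -> measurable_fun setT f.
Proof. by move=> h _ B mB; rewrite setTI; apply: mG; exact: h. Qed.

(** The Radon-Nikodym theorem on T equipped with G alone, for the charge that maps A to
    the integral of f over A. *)
Lemma cond_expectation_exists (f : T -> R) :
  P.-integrable setT (EFin \o f) -> exists Y, is_cond_expectation P G f Y.
Proof.
move=> intf.
have mphi : measurable_fun setT (id : T -> TG).
  by move=> _ B mB; rewrite setTI; apply: mG; apply/measurable_subsigma.
pose phi : {mfun T >-> TG} := HB.pack (id : T -> TG) (isMeasurableFun.Build _ _ _ _ _ mphi).
pose PG := distribution P phi.
pose nu := induced_charge intf.
have mTG (A : set TG) : measurable A -> d.-measurable (A : set T).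
  by move=> mA; apply: mG; apply/measurable_subsigma.
have h0 : nu set0 = 0%E by rewrite /nu charge0.
have h1 (A : set TG) : measurable A -> nu A \is a fin_num.
  by move=> /mTG mA; exact: fin_num_measure.
have h2 : semi_sigma_additive (nu : set TG -> \bar R).
  move=> F mF tF mUF; apply: charge_semi_sigma_additive => //; last exact: mTG.
  by move=> i; exact: mTG.
pose nuG : {charge set TG -> \bar R} := HB.pack (nu : set TG -> \bar R)
  (isCharge.Build _ TG _ (nu : set TG -> \bar R) h0 h1 h2).
have nullP (A : set T) : measurable A -> P A = 0%E -> nu A = 0%E.
  move=> mA PA; apply: null_set_integral => //.
  exact: measurable_funTS (measurable_int _ intf).
have dom : nuG `<< PG.
  apply/null_content_dominatesP => A mA PA.
  exact: nullP (mTG _ mA) PA.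
pose g := Radon_Nikodym nuG PG.
have ig : PG.-integrable setT g by exact: Radon_Nikodym_integrable.
have mg : measurable_fun setT g by exact: measurable_int ig.
have gfin x : g x \is a fin_num by exact: Radon_Nikodym_fin_num.
have gE : g = EFin \o (fun x => fine (g x)).
  by apply/funext => x /=; rewrite fineK.
exists (fun x => fine (g x)); split.
- by apply/measurable_wrtP/measurable_EFinP; rewrite -gE.
- rewrite -gE; apply/integrableP; split.
    move=> _ B mB; rewrite setTI; apply: mG; apply/measurable_subsigma.
    by rewrite -[X in measurable X]setTI; exact: mg.
  move/integrableP: ig => [_].
  by rewrite ge0_integral_distribution//; exact: measurableT_comp.
move=> A GA.
have mA : measurable (A : set TG) by apply/measurable_subsigma.
have := Radon_Nikodym_integral dom mA.
rewrite [LHS]/= /nu /induced_charge => ->.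
under eq_integral => x _ do rewrite fineK//.
have ig' : P.-integrable (phi @^-1` (A : set TG)) (g \o phi).
  apply: (integrableS measurableT) => //; first exact: mG.
  apply/integrableP; split.
    move=> _ B mB; rewrite setTI; apply: mG; apply/measurable_subsigma.
    by rewrite -[X in measurable X]setTI; exact: mg.
  move/integrableP: ig => [_].
  by rewrite ge0_integral_distribution//; exact: measurableT_comp.
by rewrite (integral_pushforward mphi mg ig' mA).
Qed.

Lemma integrable_bounded_mul (h f : T -> R) (B : R) :
  measurable_fun setT h -> (forall x, `|h x| <= B) ->
  P.-integrable setT (EFin \o f) -> P.-integrable setT (EFin \o (h \* f)).
Proof.
move=> mh hB intf.
have -> : EFin \o (h \* f) = ((EFin \o h) \* (EFin \o f))%E.
  by apply/funext => x /=; rewrite EFinM.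
apply: integrableMr => //.
by exists B; split; [exact: num_real|move=> M BM x _; exact: le_trans (hB x) (ltW BM)].
Qed.

Lemma integrable_indic_mul (f : T -> R) (A : set T) :
  measurable A -> P.-integrable setT (EFin \o f) ->
  P.-integrable setT (EFin \o (\1_A \* f)).
Proof.
move=> mA; apply: (@integrable_bounded_mul _ _ 1) => //.
by move=> x; rewrite indicE normr_nat lern1 leq_b1.
Qed.

Lemma Rintegral_indic_mul (f : T -> R) (A : set T) : measurable A ->
  \int[P]_x (\1_A x * f x) = \int[P]_(x in A) f x.
Proof.
move=> mA; rewrite [RHS]Rintegral_mkcond; apply: eq_Rintegral => x _.
by rewrite /patch indicE; case: (x \in A); rewrite ?mul1r ?mul0r.
Qed.

(** Subtracting B/2 on the event {h >= B/2} leaves a weight with values in [0, B/2]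
    and removes a nonpositive quantity from the integral. After k such steps the
    integral is at most B / 2^k times the L^1 norm of f. *)
Lemma Rintegral_mul_le0 (f h : T -> R) (B : R) :
  P.-integrable setT (EFin \o f) ->
  (forall A, G A -> \int[P]_(x in A) f x <= 0) ->
  measurable_wrt G h -> (forall x, 0 <= h x <= B) ->
  \int[P]_x (h x * f x) <= 0.
Proof.
move=> intf fle0 mh hB.
have mf : measurable_fun setT f by exact/measurable_EFinP/(measurable_int _ intf).
have intnf : P.-integrable setT (EFin \o (fun x => `|f x|)).
  by have := integrable_abse intf; apply: eq_integrable => // x _ /=.
set I := \int[P]_x `|f x|.
have I0 : 0 <= I by apply: Rintegral_ge0.
suff bound k : \int[P]_x (h x * f x) <= B / 2 ^+ k * I.
  rewrite leNgt; apply/negP => pos.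
  set r := \int[P]_x (h x * f x) in pos bound.
  have [k hk] : exists k : nat, B * I / r < k%:R.
    by exists (Num.truncn (B * I / r)).+1; exact: truncnS_gt.
  have h2 : (k%:R : R) <= 2 ^+ k by rewrite -natrX ler_nat ltnW // ltn_expl.
  have := bound k; rewrite mulrAC leNgt => /negP; apply.
  rewrite ltr_pdivrMr ?exprn_gt0// [r * _]mulrC -ltr_pdivrMr//.
  exact: lt_le_trans hk h2.
elim: k B h mh hB => [|k IH] B h mh hB.
  rewrite expr0 divr1 -RintegralZl//; apply: le_Rintegral => //.
  - apply: (@integrable_bounded_mul _ _ B) => //.
      exact: measurable_wrt_measurable.
    by move=> x; have /andP[h0 hb] := hB x; rewrite ger0_norm.
  - apply: (@integrable_bounded_mul _ _ `|B|) => //.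
  - move=> x _; have /andP[h0 hb] := hB x.
    apply: (le_trans (ler_norm _)); rewrite normrM ger0_norm//.
    exact: ler_wpM2r.
pose A := [set x | B / 2 <= h x].
have GA : G A.
  by have := mh `[(B / 2), +oo[%classic (measurable_itv _); congr G; apply/seteqP; split=> x /=;
    rewrite in_itv/= andbT.
have mA : measurable A by exact: mG.
pose h' x := h x - B / 2 * \1_A x.
have mh' : measurable_wrt G h'.
  apply/measurable_wrtP; apply: measurable_funB; first exact/measurable_wrtP.
  apply: measurable_funM; first exact: measurable_cst.
  apply: measurable_indic; exact/measurable_subsigma.
have h'B x : 0 <= h' x <= B / 2.
  have /andP[h0 hb] := hB x; rewrite /h' indicE.
  have [xA|xA] := boolP (x \in A).
    by move/set_mem : xA; rewrite /A/= => xA; lra.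
  have : ~ A x by move=> ?; move/negP: xA; apply; rewrite inE.
  by rewrite /A /= => /negP; rewrite -ltNge => xB; lra.
have := IH _ _ mh' h'B; rewrite (_ : B / 2 / 2 ^+ k = B / 2 ^+ k.+1); last by rewrite exprS invfM mulrA.
apply: le_trans.
have iA := integrable_indic_mul mA intf.
have -> : \int[P]_x (h x * f x) =
    \int[P]_x (h' x * f x) + B / 2 * \int[P]_(x in A) f x.
  rewrite -(Rintegral_indic_mul f mA) -RintegralZl//.
  rewrite -RintegralD//; last 2 first.
  - apply: (@integrable_bounded_mul _ _ (B / 2)) => //.
      exact: measurable_wrt_measurable.
    by move=> x; have /andP[h0 hb] := h'B x; rewrite ger0_norm.
  - apply: (@integrable_bounded_mul _ _ `|B / 2|) => //.
  by apply: eq_Rintegral => x _; rewrite /h'; ring.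
rewrite gerDl mulr_ge0_le0 ?fle0//.
have := hB point; lra.
Qed.

(** The previous lemma for f and - f, with the nonnegative weight h + B on A. *)
Lemma Rintegral_mul_eq0 (f h : T -> R) (B : R) (A : set T) :
  P.-integrable setT (EFin \o f) ->
  (forall A, G A -> \int[P]_(x in A) f x = 0) ->
  measurable_wrt G h -> (forall x, `|h x| <= B) -> G A ->
  \int[P]_(x in A) (h x * f x) = 0.
Proof.
move=> intf f0 mh hB GA; have mA := mG GA.
have intNf : P.-integrable setT (EFin \o (\- f)).
  by have := integrableN intf; apply: eq_integrable.
have N (g : T -> R) D : measurable D -> P.-integrable D (EFin \o g) ->
    \int[P]_(x in D) - g x = - \int[P]_(x in D) g x.
  move=> mD ig; rewrite -[RHS]mulN1r -RintegralZl//.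
  by apply: eq_Rintegral => x _; rewrite mulN1r.
have Nf0 D : G D -> \int[P]_(x in D) - f x = 0.
  move=> GD; rewrite N ?f0 ?oppr0//; first exact: mG.
  by apply: integrableS intf => //; exact: mG.
pose h' x := \1_A x * (h x + B).
have mh' : measurable_wrt G h'.
  apply/measurable_wrtP; apply: measurable_funM.
    by apply: measurable_indic; exact/measurable_subsigma.
  by apply: measurable_funD; [exact/measurable_wrtP|exact: measurable_cst].
have h'B x : 0 <= h' x <= B + B.
  have := hB x; rewrite /h' indicE ler_norml => /andP[h1 h2].
  by case: (x \in A); rewrite ?mul1r ?mul0r; lra.
have ih'f : P.-integrable setT (EFin \o (fun x => h' x * f x)).
  apply: (@integrable_bounded_mul _ _ (B + B)) => //.
    exact: measurable_wrt_measurable.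
  by move=> x; have /andP[h1 h2] := h'B x; rewrite ger0_norm.
have le1 : \int[P]_x (h' x * f x) <= 0.
  by apply: (Rintegral_mul_le0 intf) mh' h'B => D GD; rewrite f0.
have le2 : \int[P]_x (h' x * (\- f) x) <= 0.
  by apply: (Rintegral_mul_le0 intNf) mh' h'B => D GD; rewrite Nf0.
have e0 : \int[P]_x (h' x * f x) = 0.
  apply/eqP; rewrite eq_le le1/= -oppr_le0 -N//.
  by rewrite (_ : \int[P]_x - _ = \int[P]_x (h' x * (\- f) x))//;
    apply: eq_Rintegral => x _ /=; rewrite mulrN.
have ifA : P.-integrable A (EFin \o f) by exact: integrableS intf.
have ihfA : P.-integrable A (EFin \o (fun x => h x * f x)).
  apply: (@integrableS _ _ _ _ setT) => //.
  apply: (@integrable_bounded_mul _ _ B) => //.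
  exact: measurable_wrt_measurable.
have : \int[P]_(x in A) (h x * f x + B * f x) = 0.
  rewrite -e0 [LHS]Rintegral_mkcond; apply: eq_Rintegral => x _.
  by rewrite /patch /h' indicE; case: (x \in A); rewrite ?mul0r// mul1r mulrDl.
have iBf : P.-integrable A (EFin \o (fun x => B * f x)).
  by have := integrableZl mA B ifA.
by rewrite RintegralD// RintegralZl// f0// mulr0 addr0.
Qed.

(** The notion of [is_cond_expectation] with real-valued integrals, which are easier to
    add and to compare. *)
Definition cond_version (f Y : T -> R) : Prop :=
  [/\ measurable_wrt G Y, P.-integrable setT (EFin \o Y) &
      forall A, G A -> \int[P]_(x in A) Y x = \int[P]_(x in A) f x].

Lemma cond_version_exists (f : T -> R) :
  P.-integrable setT (EFin \o f) -> exists Y, cond_version f Y.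
Proof.
move=> /cond_expectation_exists[Y [mY iY YE]]; exists Y; split => // A GA.
by rewrite /Rintegral YE.
Qed.

Lemma integrable_on (f : T -> R) (A : set T) : measurable A ->
  P.-integrable setT (EFin \o f) -> P.-integrable A (EFin \o f).
Proof. by move=> mA; exact: integrableS. Qed.

Lemma cond_versionN (f Y : T -> R) : P.-integrable setT (EFin \o f) ->
  cond_version f Y -> cond_version (\- f) (\- Y).
Proof.
move=> intf [mY iY YE]; split.
- by apply/measurable_wrtP; apply: measurableT_comp => //; exact/measurable_wrtP.
- by have := integrableN iY; apply: eq_integrable.
move=> A GA; have mA := mG GA.
have N (g : T -> R) : P.-integrable setT (EFin \o g) ->
    \int[P]_(x in A) - g x = - \int[P]_(x in A) g x.
  move=> ig; rewrite -[RHS]mulN1r -RintegralZl//; last exact: integrable_on.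
  by apply: eq_Rintegral => x _; rewrite mulN1r.
by rewrite !N// YE.
Qed.

(** On the part of A where Y >= c the integral of Y - c is nonnegative, and it is
    nonpositive as it equals that of f - c. Hence it vanishes and the minimum has the
    same integrals as Y. Compared with an almost sure bound on Y this gives a version
    bounded at every point. *)
Lemma cond_version_min (f Y : T -> R) (c : R) : cond_version f Y ->
  (forall A, G A -> \int[P]_(x in A) f x <= \int[P]_(x in A) c) ->
  cond_version f (fun x => Num.min (Y x) c).
Proof.
move=> [mY iY YE] fc.
have mYT : measurable_fun setT Y by exact: measurable_wrt_measurable.
have ic : P.-integrable setT (EFin \o cst c).
  exact: finite_measure_integrable_cst.
have mmin : measurable_wrt G (fun x => Num.min (Y x) c).
  apply/measurable_wrtP; apply: measurable_minr; last exact: measurable_cst.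
  exact/measurable_wrtP.
have imin : P.-integrable setT (EFin \o (fun x => Num.min (Y x) c)).
  have iYc : P.-integrable setT ((abse \o (EFin \o Y)) \+ (abse \o (EFin \o cst c))).
    by apply: integrableD => //; exact: integrable_abse.
  apply: le_integrable iYc => //.
    by apply/measurable_EFinP; exact: measurable_wrt_measurable mmin.
  move=> x _ /=; rewrite lee_fin [leRHS]ger0_norm ?addr_ge0// minEle.
  by case: ifP => _; rewrite ?lerDl ?lerDr.
split => // A GA; rewrite -YE//.
pose N := [set x | c <= Y x].
have GN : G N.
  have := mY `[c, +oo[%classic (measurable_itv _); congr G.
  by apply/seteqP; split=> x /=; rewrite in_itv/= andbT.
have GAN : G (A `&` N).
  apply/measurable_subsigma; apply: measurableI; exact/measurable_subsigma.
have mA := mG GA; have mAN := mG GAN.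
apply/eqP; rewrite eq_sym -subr_eq0 -RintegralB//; [|exact: integrable_on..].
have -> : \int[P]_(x in A) (Y x - Num.min (Y x) c) =
          \int[P]_(x in A `&` N) (Y x - c).
  rewrite Rintegral_mkcondr; apply: eq_Rintegral => x xA.
  rewrite /patch; case: ifPn => [/set_mem|/negP xN].
    by rewrite /N/= => cY; rewrite min_r.
  by rewrite min_l ?subrr// leNgt; apply/negP => Yc; apply: xN; rewrite inE /N/= ltW.
rewrite eq_le; apply/andP; split; last first.
  by apply: Rintegral_ge0 => x [_]; rewrite /N/= => ?; rewrite subr_ge0.
rewrite RintegralB//; [|exact: integrable_on..].
by rewrite YE// subr_le0 fc.
Qed.

Lemma cond_version_clip (f Y : T -> R) (c : R) : P.-integrable setT (EFin \o f) ->
  (forall x, `|f x| <= c) -> cond_version f Y -> exists2 W, cond_version f W & forall x, `|W x| <= c.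
Proof.
move=> intf fc vY.
have ic : P.-integrable setT (EFin \o cst c).
  exact: finite_measure_integrable_cst.
have v1 : cond_version f (fun x => Num.min (Y x) c).
  apply: cond_version_min => // A GA; have mA := mG GA.
  apply: le_Rintegral => //; [exact: integrable_on..|move=> x _].
  exact: le_trans (ler_norm _) (fc x).
have intNf : P.-integrable setT (EFin \o (\- f)).
  by have := integrableN intf; apply: eq_integrable.
have v2 : cond_version (\- f) (fun x => Num.min (- Num.min (Y x) c) c).
  apply: cond_version_min => [|A GA]; first exact: cond_versionN.
  have mA := mG GA.
  apply: le_Rintegral => //; [exact: integrable_on..|move=> x _].
  by apply: (le_trans (ler_norm _)); rewrite normrN.
have := cond_versionN intNf v2; rewrite (_ : \- \- f = f); last first.
  by apply/funext => x /=; rewrite opprK.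
move=> v3; eexists; first exact: v3.
move=> x /=; rewrite normrN ler_norml; have := fc x; rewrite ler_norml => /andP[f1 f2].
by rewrite ge_min lexx orbT andbT le_min lerN2 ge_min lexx orbT/=; lra.
Qed.

Definition trunc_at (u : R) (f : T -> R) (x : T) : R :=
  if `|f x| <= u then f x else 0.

Lemma trunc_at_le (u : R) (f : T -> R) x : 0 <= u -> `|trunc_at u f x| <= u.
Proof. by move=> u0; rewrite /trunc_at; case: ifP => //; rewrite normr0. Qed.

Lemma measurable_trunc_at (u : R) (f : T -> R) : measurable_fun setT f ->
  measurable_fun setT (trunc_at u f).
Proof.
move=> mf; apply: measurable_fun_ifT => //.
by apply: measurable_fun_ler => //; exact: measurableT_comp.
Qed.

(** Let f' be the truncation of f, let W with |W| <= u be a version of E(f' | G),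
    and let Y <= 0 be one of E(f | G). Then V = Y - W compensates f - f' exactly,
    but it is unbounded below. Its truncation Vh = max(V, - u) keeps both drifts
    nonpositive: that of f - f' - Vh since Vh >= V, and that of f' + Vh since
    W + Vh = max(Y, W - u) <= 0. The last clause expresses that Vh lies between 0
    and V; it controls the second moment of f - f' - Vh. *)
Lemma truncation_compensator (f : T -> R) (u : R) : 0 < u ->
  P.-integrable setT (EFin \o f) ->
  (forall A, G A -> \int[P]_(x in A) f x <= 0) ->
  exists Vh V : T -> R,
  [/\ measurable_wrt G Vh, forall x, `|Vh x| <= u,
      P.-integrable setT (EFin \o V) &
  [/\ forall A, G A -> \int[P]_(x in A) (trunc_at u f x + Vh x) <= 0,
      forall A, G A -> \int[P]_(x in A) (f x - trunc_at u f x - Vh x) <= 0,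
      forall A, G A -> \int[P]_(x in A) (f x - trunc_at u f x - V x) = 0 &
      forall x, Vh x ^+ 2 <= Vh x * V x]].
Proof.
move=> u0 intf fle0.
have mf : measurable_fun setT f by exact/measurable_EFinP/(measurable_int _ intf).
have tru x := @trunc_at_le u f x (ltW u0).
have intt : P.-integrable setT (EFin \o trunc_at u f).
  by apply: (@bounded_integrable _ _ _ _ _ u) => //; exact: measurable_trunc_at.
have [W0 vW0] := cond_version_exists intt.
have [W [mW iW WE] Wu] := cond_version_clip intt tru vW0.
have [Y0 vY0] := cond_version_exists intf.
have [mY iY YE] : cond_version f (fun x => Num.min (Y0 x) 0).
  by apply: cond_version_min => // A GA; rewrite [X in _ <= X]/Rintegral integral0 fle0.
set Y := (fun x => Num.min (Y0 x) 0) in mY iY YE.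
have Y0' x : Y x <= 0 by rewrite /Y ge_min lexx orbT.
pose V x := Y x - W x.
pose Vh x := Num.max (V x) (- u).
have iV : P.-integrable setT (EFin \o V) by have := integrableB measurableT iY iW.
have mVh : measurable_wrt G Vh.
  apply/measurable_wrtP; apply: measurable_maxr; last exact: measurable_cst.
  by apply: measurable_funB; exact/measurable_wrtP.
have Wu' x : - u <= W x <= u by rewrite -ler_norml.
have Vhu x : `|Vh x| <= u.
  rewrite ler_norml /Vh le_max lexx orbT/= ge_max /V.
  by have := Wu' x; have := Y0' x; lra.
have iVh : P.-integrable setT (EFin \o Vh).
  by apply: (@bounded_integrable _ _ _ _ _ u) => //; exact: measurable_wrt_measurable.
have if2 : P.-integrable setT (EFin \o (fun x => f x - trunc_at u f x)).
  by have := integrableB measurableT intf intt.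
exists Vh, V; split => //; split => [A GA|A GA|A GA|x].
- have mA := mG GA.
  rewrite RintegralD//; [|exact: integrable_on..]; rewrite -WE// -RintegralD//; [|exact: integrable_on..].
  rewrite -[leRHS](_ : \int[P]_(x in A) 0 = 0); last by rewrite /Rintegral integral0.
  have i0 : P.-integrable setT (EFin \o (cst 0 : T -> R)) by exact: integrable0.
  apply: le_Rintegral => //; [|exact: integrable_on i0|].
    by apply: integrable_on => //; have := integrableD measurableT iW iVh.
  move=> x _; rewrite /Vh /V -lerBrDl sub0r ge_max.
  by have := Wu' x; have := Y0' x; lra.
- have mA := mG GA.
  have e0 : \int[P]_(x in A) (f x - trunc_at u f x) = \int[P]_(x in A) V x.
    rewrite RintegralB//; [|exact: integrable_on..].
    by rewrite -YE// -WE// -RintegralB//; exact: integrable_on.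
  rewrite RintegralB//; [|exact: integrable_on..].
  rewrite subr_le0 e0; apply: le_Rintegral => //; [exact: integrable_on..|].
  by move=> x _; rewrite /Vh le_max lexx.
- have mA := mG GA.
  have e0 : \int[P]_(x in A) (f x - trunc_at u f x) = \int[P]_(x in A) V x.
    rewrite RintegralB//; [|exact: integrable_on..].
    by rewrite -YE// -WE// -RintegralB//; exact: integrable_on.
  by rewrite RintegralB//; [rewrite e0 subrr|exact: integrable_on..].
rewrite /Vh expr2; case: (lerP (V x) (- u)) => // Vu; rewrite !mulNr lerN2 ler_wpM2l //; exact: ltW.
Qed.

End SubSigma.

(** * The maximal inequality for potentials *)

Section Maximal.
Context {R : realType} {d : measure_display} {T : measurableType d}.
Variable (P : probability T R).

Definition stay_below (Phi : nat -> T -> R) (L : R) (k : nat) : set T :=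
  [set x | forall j, (j <= k)%N -> Phi j x < L].

Lemma stay_belowS (Phi : nat -> T -> R) (L : R) k :
  stay_below Phi L k.+1 = stay_below Phi L k `&` [set x | Phi k.+1 x < L].
Proof.
apply/seteqP; split=> x /=.
  by move=> h; split=> [j jk|]; apply: h => //; exact: leqW.
by move=> [h hk] j; rewrite leq_eqVlt => /predU1P[->//|]; exact: h.
Qed.

Lemma stay_below0 (Phi : nat -> T -> R) (L : R) :
  stay_below Phi L 0 = [set x | Phi 0%N x < L].
Proof.
by apply/seteqP; split=> x /=; [exact|move=> h j; rewrite leqn0 => /eqP ->].
Qed.

Lemma measurable_stay_below (Phi : nat -> T -> R) (L : R) k :
  (forall k, measurable_fun setT (Phi k)) -> measurable (stay_below Phi L k).
Proof.
move=> mPhi.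
have mlt j : measurable [set x | Phi j x < L].
  have := mPhi j measurableT _ (measurable_itv `]-oo, L[); rewrite setTI.
  by congr measurable; apply/seteqP; split=> x /=; rewrite in_itv.
elim: k => [|k IH]; first by rewrite stay_below0.
by rewrite stay_belowS; exact: measurableI.
Qed.

(** Induction on k. The part of the potential that reaches L at step k + 1 is at least
    L times the probability of this event, and the remaining part has grown by at most
    c in mean. *)
Lemma potential_maximal_inequality (Phi : nat -> T -> R) (L c : R) :
  0 <= L ->
  (forall k, measurable_fun setT (Phi k)) -> (forall k x, 0 <= Phi k x) ->
  (forall k, \int[P]_(x in stay_below Phi L k) (Phi k.+1 x)%:E <=
    \int[P]_(x in stay_below Phi L k) (Phi k x)%:E + c%:E)%E ->
  forall k, (L%:E * P (~` stay_below Phi L k)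
    + \int[P]_(x in stay_below Phi L k) (Phi k x)%:E
    <= \int[P]_x (Phi 0%N x)%:E + (k%:R * c)%:E)%E.
Proof.
move=> L0 mPhi Phi0 step.
have mN k := measurable_stay_below L k mPhi.
have mPE D k : measurable_fun D (EFin \o Phi k).
  by apply/measurable_EFinP; exact: measurable_funTS.
have markov (A : set T) k : measurable A -> (forall x, A x -> L <= Phi k x) ->
    (L%:E * P A <= \int[P]_(x in A) (Phi k x)%:E)%E.
  move=> mA AL; rewrite -integral_cst//; apply: ge0_le_integral => //.
  exact: mPE.
elim=> [|k IH].
  rewrite mul0r adde0 -[in leRHS](setvU (stay_below Phi L 0)).
  rewrite ge0_integral_setU//=; last 4 first.
  - exact: measurableC.
  - exact: mPE.
  - by move=> x _; rewrite lee_fin.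
  - by apply/disj_setPS => x [].
  rewrite leeD2r//; apply: markov; first exact: measurableC.
  by move=> x; rewrite stay_below0 /= => /negP; rewrite -leNgt.
set N := stay_below Phi L k in IH *; set N' := stay_below Phi L k.+1.
have N'E : N' = N `&` [set x | Phi k.+1 x < L] by exact: stay_belowS.
pose H := N `\` N'.
have mH : measurable H by exact: measurableD (mN k) (mN k.+1).
have CN' : ~` N' = ~` N `|` H.
  rewrite /H N'E; apply/seteqP; split=> x /=.
    move=> h; have [Nx|Nx] := pselect (N x); last by left.
    by right; split.
  by move=> [h [? _]|[]//]; exact: h.
have HL x : H x -> L <= Phi k.+1 x.
  by rewrite /H N'E /= => -[Nx] h; rewrite leNgt; apply/negP => ?; exact: h.
have NU : N = H `|` N' by rewrite /H setDKU // N'E; exact: subIsetl.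
rewrite CN' measureU//; last 2 first.
- by apply: measurableC; exact: mN.
- by apply/seteqP; split=> x //= -[? []].
rewrite ge0_muleDr// -addeA.
apply: (@le_trans _ _ (L%:E * P (~` N) + \int[P]_(x in N) (Phi k.+1 x)%:E)%E).
  rewrite leeD2l// [in leRHS]NU ge0_integral_setU//=; last 4 first.
  - exact: mN.
  - exact: mPE.
  - by move=> x _; rewrite lee_fin.
  - by apply/disj_setPS => x [] [].
  by rewrite leeD2r//; exact: markov.
apply: (le_trans (leeD2l _ (step k))).
rewrite (_ : (k.+1%:R * c)%:E = ((k%:R * c)%:E + c%:E)%E); last first.
  by rewrite -EFinD -natr1 mulrDl mul1r.
rewrite [leLHS]addeA [leRHS]addeA; exact: leeD2r.
Qed.

Variable F : nat -> set (set T).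
Hypothesis fF : filtration F.

Let sF i : sigma_algebra setT (F i). Proof. by case: fF. Qed.
Let mF i : F i `<=` measurable. Proof. by case: fF. Qed.

Lemma filtration_le i j : (i <= j)%N -> F i `<=` F j.
Proof.
move=> /subnK <-; elim: (j - i)%N => [//|k IH] A /IH.
by case: fF => _ _; exact.
Qed.

Lemma measurable_wrt_le i j (f : T -> R) : (i <= j)%N ->
  measurable_wrt (F i) f -> measurable_wrt (F j) f.
Proof. by move=> ij h B /h; exact: filtration_le. Qed.

Lemma filtration_stay_below (Phi : nat -> T -> R) (L : R) k :
  (forall k, measurable_wrt (F k) (Phi k)) -> F k (stay_below Phi L k).
Proof.
move=> mPhi.
have lt j : F j [set x | Phi j x < L].
  have := mPhi j `]-oo, L[%classic (measurable_itv _); congr (F j _).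
elim: k => [|k IH]; first by rewrite stay_below0.
rewrite stay_belowS; apply/(measurable_subsigma (sF _)); apply: measurableI.
  by apply/(measurable_subsigma (sF _)); exact: filtration_le IH.
by apply/(measurable_subsigma (sF _)).
Qed.

(** How the hypothesis of [potential_maximal_inequality] is checked: the term h f, with a
    bounded nonnegative weight h from the past and an increment f, does not increase
    the integral, and q accounts for the growth. *)
Lemma potential_step (k : nat) (A : set T) (Phi Phi' h f q : T -> R) (L B c : R) :
  F k A ->
  measurable_fun setT Phi -> measurable_fun setT Phi' ->
  (forall x, A x -> 0 <= Phi x <= L) -> (forall x, 0 <= Phi' x) ->
  measurable_wrt (F k) h -> (forall x, A x -> 0 <= h x <= B) ->
  P.-integrable setT (EFin \o f) ->
  (forall A', F k A' -> \int[P]_(x in A') f x <= 0) ->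
  P.-integrable setT (EFin \o q) -> \int[P]_(x in A) q x <= c ->
  (forall x, A x -> Phi' x <= Phi x + h x * f x + q x) ->
  (\int[P]_(x in A) (Phi' x)%:E <= \int[P]_(x in A) (Phi x)%:E + c%:E)%E.
Proof.
move=> FA mPhi mPhi' PhiL Phi'0 mh hB intf fle0 intq qc le.
have mA := mF FA.
pose hA := (\1_A \* h).
have mhA : measurable_wrt (F k) hA.
  apply/(measurable_wrtP (sF _)); apply: measurable_funM; last exact/(measurable_wrtP (sF _)).
  by apply: measurable_indic; apply/(measurable_subsigma (sF _)).
have hAB x : 0 <= hA x <= `|B|.
  rewrite /hA /= indicE; have [/set_mem xA|_] := boolP (x \in A).
    by have /andP[h0 hb] := hB x xA; rewrite mul1r h0 (le_trans hb)// ler_norm.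
  by rewrite mul0r lexx normr_ge0.
have ihf : P.-integrable setT (EFin \o (hA \* f)).
  apply: (@integrable_bounded_mul _ _ _ _ _ _ `|B|) => //.
    exact: (measurable_wrt_measurable (@mF k)).
  by move=> x; have /andP[h0 hb] := hAB x; rewrite ger0_norm.
have hf0 : \int[P]_(x in A) (hA x * f x) <= 0.
  have := Rintegral_mul_le0 (sF k) (@mF k) intf fle0 mhA hAB.
  rewrite (_ : \int[P]_x (hA x * f x) = \int[P]_(x in A) (hA x * f x))//.
  rewrite [RHS]Rintegral_mkcond; apply: eq_Rintegral => x _.
  by rewrite /patch /hA/= indicE; case: (x \in A); rewrite ?mul0r.
have iPhi : P.-integrable A (EFin \o Phi).
  apply: measurable_bounded_integrable => //.
  - by rewrite (le_lt_trans (probability_le1 _ _))// ltry.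
  - exact: measurable_funTS.
  - exists L; split; [exact: num_real|move=> M LM x Ax].
    have /andP[p0 pl] := PhiL x Ax.
    by rewrite /= ger0_norm// (le_trans pl)// ltW.
have ihf' : P.-integrable A (EFin \o (hA \* f)) by exact: integrable_on.
have iq' : P.-integrable A (EFin \o q) by exact: integrable_on.
have i1 : P.-integrable A (EFin \o (fun x => Phi x + hA x * f x)).
  by have := integrableD mA iPhi ihf'.
have i2 : P.-integrable A (EFin \o (fun x => Phi x + hA x * f x + q x)).
  by have := integrableD mA i1 iq'.
apply: (@le_trans _ _ (\int[P]_(x in A) (Phi x + hA x * f x + q x)%:E)%E).
  apply: ge0_le_integral => //.
  - by move=> x _; rewrite lee_fin.
  - by apply/measurable_EFinP; exact: measurable_funTS.
  - exact: measurable_int i2.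
  - move=> x Ax; rewrite lee_fin /hA /= indicE mem_set// mul1r; exact: le.
have toR (g : T -> R) : P.-integrable A (EFin \o g) ->
    (\int[P]_(x in A) (g x)%:E = (\int[P]_(x in A) g x)%:E)%E.
  by move=> ig; rewrite /Rintegral fineK//; exact: integrable_fin_num.
rewrite !toR// -EFinD lee_fin RintegralD// RintegralD//; lra.
Qed.

End Maximal.

(** * Tail bounds for bounded and for square-integrable increments *)

Section Tails.
Context {R : realType} {d : measure_display} {T : measurableType d}.
Variable (P : probability T R) (F : nat -> set (set T)).
Hypothesis fF : filtration F.

Let sF i : sigma_algebra setT (F i). Proof. by case: fF. Qed.
Let mF i : F i `<=` measurable. Proof. by case: fF. Qed.

Lemma measurable_wrt_comp i (g : R -> R) (f : T -> R) :
  measurable_fun setT g -> measurable_wrt (F i) f ->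
  measurable_wrt (F i) (fun x => g (f x)).
Proof.
move=> mg /(measurable_wrtP (sF i)) mf; apply/(measurable_wrtP (sF i)).
exact: (measurableT_comp mg mf).
Qed.

Lemma measurable_wrtD i (f g : T -> R) : measurable_wrt (F i) f ->
  measurable_wrt (F i) g -> measurable_wrt (F i) (f \+ g).
Proof.
move=> /(measurable_wrtP (sF i)) mf /(measurable_wrtP (sF i)) mg.
by apply/(measurable_wrtP (sF i)); exact: measurable_funD.
Qed.

Lemma measurable_wrtM i (f g : T -> R) : measurable_wrt (F i) f ->
  measurable_wrt (F i) g -> measurable_wrt (F i) (f \* g).
Proof.
move=> /(measurable_wrtP (sF i)) mf /(measurable_wrtP (sF i)) mg.
by apply/(measurable_wrtP (sF i)); exact: measurable_funM.
Qed.

Lemma measurable_wrt_cst i (c : R) : measurable_wrt (F i) (cst c).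
Proof. by apply/(measurable_wrtP (sF i)); exact: measurable_cst. Qed.

Lemma measurable_wrt_sum (D : nat -> T -> R) k :
  (forall i, measurable_wrt (F i.+1) (D i)) ->
  measurable_wrt (F k) (fun x => \sum_(i < k) D i x).
Proof.
move=> mD; elim: k => [|k IH].
  under eq_fun do rewrite big_ord0; exact: measurable_wrt_cst.
under eq_fun do rewrite big_ord_recr/=.
by apply: measurable_wrtD => //; exact: measurable_wrt_le IH.
Qed.

(** The potential is exp(lam S_k - k (lam u)^2). The predictable v_k factors out of the
    exponential of the increment. The chord bound on exp(lam t_k) is affine in t_k,
    so that by the drift condition t_k may be replaced with - v_k in it, and
    [two_point_mgf_le] concludes. *)
Lemma supermartingale_azuma (t v : nat -> T -> R) (u lam y : R) (n : nat) :
  0 < u -> 0 <= lam ->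
  (forall i, measurable_wrt (F i.+1) (t i)) ->
  (forall i, measurable_wrt (F i) (v i)) ->
  (forall i x, `|t i x| <= u) -> (forall i x, `|v i x| <= u) ->
  (forall i A, F i A -> \int[P]_(x in A) (t i x + v i x) <= 0) ->
  (P [set x | exists2 k : nat, (k <= n)%N & (y <= \sum_(i < k) (t i x + v i x))%R]
   <= (expR (- (lam * y) + n%:R * (lam * u) ^+ 2))%:E)%E.
Proof.
move=> u0 lam0 mt mv tu vu drift.
pose a := lam * u.
have a0 : 0 <= a by rewrite mulr_ge0 // ltW.
pose D i x := t i x + v i x.
pose S k x := \sum_(i < k) D i x.
have mD i : measurable_wrt (F i.+1) (D i).
  by apply: measurable_wrtD => //; exact: measurable_wrt_le (mv i).
have mS k : measurable_wrt (F k) (S k) by exact: measurable_wrt_sum.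
pose Phi k x := expR (lam * S k x - k%:R * a ^+ 2).
have mPhi k : measurable_wrt (F k) (Phi k).
  apply: measurable_wrt_comp => //.
  apply: measurable_wrtD; last exact: measurable_wrt_cst.
  by apply: measurable_wrtM => //; exact: measurable_wrt_cst.
have mPhiT k : measurable_fun setT (Phi k).
  exact: (measurable_wrt_measurable (@mF k)).
pose L := expR (lam * y - n%:R * a ^+ 2).
have iD i : P.-integrable setT (EFin \o D i).
  apply: (@bounded_integrable _ _ _ _ _ (u + u)).
    exact: (measurable_wrt_measurable (@mF i.+1)).
  by move=> x; rewrite /D (le_trans (ler_normD _ _))// lerD.
pose C := (expR a + expR (- a)) / 2.
pose Sh := (expR a - expR (- a)) / 2.
have Sh0 : 0 <= Sh.
  rewrite /Sh divr_ge0// subr_ge0 ler_expR; lra.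
have step k : (\int[P]_(x in stay_below Phi L k) (Phi k.+1 x)%:E <=
    \int[P]_(x in stay_below Phi L k) (Phi k x)%:E + 0%:E)%E.
  pose h x := Phi k x * (expR (- (a ^+ 2)) * Sh / u * expR (lam * v k x)).
  apply: (@potential_step _ _ _ P F fF k _ _ _ h (D k) (cst 0) L
    (L * (expR (- (a ^+ 2)) * Sh / u * expR a)) 0).
  - exact: filtration_stay_below.
  - exact: mPhiT.
  - exact: mPhiT.
  - by move=> x Nx; rewrite expR_ge0 ltW //; exact: Nx.
  - by move=> x; exact: expR_ge0.
  - apply: measurable_wrtM => //; apply: measurable_wrtM; first exact: measurable_wrt_cst.
    apply: measurable_wrt_comp => //.
    by apply: measurable_wrtM => //; exact: measurable_wrt_cst.
  - have c0 : 0 <= expR (- (a ^+ 2)) * Sh / u.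
      by rewrite divr_ge0 ?(ltW u0)// mulr_ge0 ?expR_ge0.
    move=> x Nx; apply/andP; split.
      by apply: mulr_ge0; [exact: expR_ge0|apply: mulr_ge0 => //; exact: expR_ge0].
    have PhiL : Phi k x <= L by exact: ltW (Nx k (leqnn k)).
    apply: ler_pM => //; first exact: expR_ge0.
      by apply: mulr_ge0 => //; exact: expR_ge0.
    rewrite ler_wpM2l // ler_expR /a ler_wpM2l //.
    exact: le_trans (ler_norm _) (vu k x).
  - exact: iD.
  - exact: drift.
  - exact: integrable0.
  - by rewrite /Rintegral integral0.
  move=> x _ /=; rewrite addr0.
  have -> : Phi k.+1 x = Phi k x * (expR (- (a ^+ 2)) *
      (expR (lam * v k x) * expR (lam * t k x))).
    rewrite /Phi /S big_ord_recr/= -!expRD; congr expR.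
    by rewrite /D -natr1; ring.
  have -> : Phi k x + h x * D k x = Phi k x *
      (1 + expR (- (a ^+ 2)) * (Sh * (u^-1 * (expR (lam * v k x) * D k x)))).
    by rewrite /h; ring.
  rewrite ler_wpM2l ?expR_ge0//.
  have chord : expR (lam * t k x) <= C + t k x / u * Sh.
    by apply: expR_le_chord => //; rewrite -ler_norml.
  have tp : expR (lam * v k x) * (C - v k x / u * Sh) <= expR (a ^+ 2).
    have := @two_point_mgf_le _ a (v k x / u).
    rewrite /a -!mulrA [u * _]mulrC divfK ?gt_eqF// !mulrA -/a; apply.
    by rewrite -ler_norml normrM normfV (gtr0_norm u0) ler_pdivrMr ?mul1r.
  have ee : expR (- (a ^+ 2)) * expR (a ^+ 2) = 1.
    by rewrite -expRD addNr expR0.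
  apply: (@le_trans _ _ (expR (- (a ^+ 2)) *
     (expR (lam * v k x) * (C + t k x / u * Sh)))).
    by rewrite !ler_wpM2l ?expR_ge0.
  have -> : expR (- (a ^+ 2)) * (expR (lam * v k x) * (C + t k x / u * Sh)) =
     expR (- (a ^+ 2)) * (expR (lam * v k x) * (C - v k x / u * Sh)) +
     expR (- (a ^+ 2)) * (Sh * (u^-1 * (expR (lam * v k x) * D k x))).
    by rewrite /D; ring.
  by rewrite lerD2r -[leRHS]ee ler_wpM2l ?expR_ge0.
have := @potential_maximal_inequality _ _ _ P Phi L 0 (expR_ge0 _) mPhiT
   (fun k x => expR_ge0 _) step n.
rewrite mulr0 adde0 => H.
have {}H : (L%:E * P (~` stay_below Phi L n) <= 1)%E.
  have -> : (1 = \int[P]_x (Phi 0%N x)%:E)%E.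
    under eq_integral => x _ do rewrite /Phi /S big_ord0 mulr0 mul0r subr0 expR0.
    by rewrite integral_cst// mul1e; apply/esym; exact: probability_setT.
  apply: le_trans H; rewrite leeDl//.
  by apply: integral_ge0 => x _; rewrite lee_fin expR_ge0.
have L0 : 0 < L by exact: expR_gt0.
have -> : expR (- (lam * y) + n%:R * (lam * u) ^+ 2) = L^-1.
  by rewrite /L -expRN -/a; congr expR; ring.
apply: (@le_trans _ _ (P (~` stay_below Phi L n))).
  apply: le_measure; rewrite ?inE.
  - by apply: measurable_some_ge => k; exact: (measurable_wrt_measurable (@mF k)).
  - by apply: measurableC; exact: measurable_stay_below.
  - move=> x [k kn yS] /(_ k kn); rewrite ltNge => /negP; apply.
    rewrite ler_expR lerB//; first by rewrite ler_wpM2l.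
    by rewrite ler_wpM2r ?sqr_ge0// ler_nat.
by rewrite -(mul1r L^-1) EFinM lee_pdivlMr // muleC.
Qed.

(** The potential is max(S_k, 0)^2. The increment of this square is at most
    2 max(S_k, 0) Z_k + Z_k^2, and the weight max(S_k, 0) is bounded as long as the
    level y has not been reached. The majorant q_k may exceed Z_k^2 by terms that
    integrate to 0 over the events of the past. *)
Lemma supermartingale_kolmogorov (Z q : nat -> T -> R) (c y : R) (n : nat) :
  0 < y ->
  (forall i, measurable_wrt (F i.+1) (Z i)) ->
  (forall i, P.-integrable setT (EFin \o Z i)) ->
  (forall i A, F i A -> \int[P]_(x in A) Z i x <= 0) ->
  (forall i, P.-integrable setT (EFin \o q i)) ->
  (forall i x, Z i x ^+ 2 <= q i x) ->
  (forall i A, F i A -> \int[P]_(x in A) q i x <= c) ->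
  (P [set x | exists2 k : nat, (k <= n)%N & (y <= \sum_(i < k) Z i x)%R]
   <= (n%:R * c / y ^+ 2)%:E)%E.
Proof.
move=> y0 mZ iZ drift iq Zq qc.
pose S k x := \sum_(i < k) Z i x.
have mS k : measurable_wrt (F k) (S k) by exact: measurable_wrt_sum.
pose Sp k x := Num.max (S k x) 0.
have mSp k : measurable_wrt (F k) (Sp k).
  by apply: (@measurable_wrt_comp _ (fun r => Num.max r 0)) => //; exact: measurable_maxr.
pose Phi k x := Sp k x ^+ 2.
have mPhi k : measurable_wrt (F k) (Phi k).
  by apply: (@measurable_wrt_comp _ (fun r => r ^+ 2)).
have mPhiT k : measurable_fun setT (Phi k).
  exact: (measurable_wrt_measurable (@mF k)).
pose L := y ^+ 2.
have Sp0 k x : 0 <= Sp k x by rewrite /Sp le_max lexx orbT.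
have step k : (\int[P]_(x in stay_below Phi L k) (Phi k.+1 x)%:E <=
    \int[P]_(x in stay_below Phi L k) (Phi k x)%:E + c%:E)%E.
  apply: (@potential_step _ _ _ P F fF k _ _ _ (fun x => 2 * Sp k x) (Z k) (q k) L
    (2 * y) c).
  - exact: filtration_stay_below.
  - exact: mPhiT.
  - exact: mPhiT.
  - by move=> x Nx; rewrite sqr_ge0 ltW //; exact: Nx.
  - by move=> x; exact: sqr_ge0.
  - by apply: measurable_wrtM => //; exact: measurable_wrt_cst.
  - move=> x Nx; rewrite mulr_ge0//= ler_pM2l//.
    have := Nx k (leqnn _); rewrite /Phi /L ltr_pXn2r ?nnegrE// ?(ltW y0)//.
    exact: ltW.
  - exact: iZ.
  - exact: drift.
  - exact: iq.
  - by apply: qc; exact: filtration_stay_below.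
  move=> x _; rewrite /Phi.
  have -> : Sp k.+1 x = Num.max (S k x + Z k x) 0 by rewrite /Sp /S big_ord_recr.
  have := Zq k x; rewrite /Sp.
  by have [s0|s0] := lerP (S k x) 0; have [z0|z0] := lerP (S k x + Z k x) 0; nra.
have := @potential_maximal_inequality _ _ _ P Phi L c (sqr_ge0 _) mPhiT
   (fun k x => sqr_ge0 _) step n.
rewrite [X in (_ <= X + _)%E](_ : _ = 0%E) ?add0e; last first.
  apply: integral0_eq => x _; rewrite /Phi /Sp /S big_ord0.
  by rewrite (max_idPl _)// expr0n.
move=> H.
have {}H : (L%:E * P (~` stay_below Phi L n) <= (n%:R * c)%:E)%E.
  apply: le_trans H; rewrite leeDl//.
  by apply: integral_ge0 => x _; rewrite lee_fin sqr_ge0.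
have L0 : 0 < L by rewrite exprn_gt0.
apply: (@le_trans _ _ (P (~` stay_below Phi L n))).
  apply: le_measure; rewrite ?inE.
  - by apply: measurable_some_ge => k; exact: (measurable_wrt_measurable (@mF k)).
  - by apply: measurableC; exact: measurable_stay_below.
  - move=> x [k kn yS] /(_ k kn); rewrite ltNge => /negP; apply.
    rewrite /L /Phi ler_pXn2r ?nnegrE// ?(ltW y0)//.
    by rewrite /Sp le_max yS.
by rewrite EFinM lee_pdivlMr // muleC.
Qed.

End Tails.

(** * The upper bound at a given truncation level *)

Section UpperBound.
Context {R : realType} {d : measure_display} {T : measurableType d}.
Variable (P : probability T R).

Lemma supermartingale_drift (F : nat -> set (set T)) (X : nat -> T -> R) (i : nat) A :
  supermartingale_differences P F X -> F i A -> \int[P]_(x in A) X i.+1 x <= 0.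
Proof.
move=> [[sF mF _] adX sup] FA.
have mA := mF i _ FA.
have [Y [[mY iY YE] Y0]] := sup i.+1 isT.
have mYT : measurable_fun setT (EFin \o Y) by exact: measurable_int iY.
rewrite /Rintegral -(YE A FA) -[leRHS]/(fine 0) fine_le//.
  by apply: integrable_fin_num => //; exact: integrableS iY.
rewrite (ae_eq_integral (fun x => (Num.min (Y x) 0)%:E))//.
- rewrite (_ : (fun x => (Num.min (Y x) 0)%:E) = (fun x => - (- Num.min (Y x) 0)%:E)%E).
    have nonneg x : A x -> (0 <= (- Num.min (Y x) 0)%:E)%E.
      by move=> _; rewrite lee_fin oppr_ge0 ge_min lexx orbT.
    by rewrite integral_ge0N// oppe_le0; exact: integral_ge0.
  by apply/funext => x; rewrite -EFinN opprK.
- exact: measurable_funTS.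
- apply/measurable_EFinP; apply: measurable_minr; last exact: measurable_cst.
  by apply: measurable_funTS; exact/measurable_EFinP.
- by apply: filterS Y0 => x Yx _; rewrite min_l.
Qed.

Lemma partial_sum_ord (X : nat -> T -> R) k w :
  partial_sum X k w = \sum_(i < k) X i.+1 w.
Proof. by rewrite /partial_sum big_add1 /= big_mkord. Qed.

Lemma max_partial_sum_attained (X : nat -> T -> R) (n : nat) w : (1 <= n)%N ->
  exists2 k, (k <= n)%N & max_partial_sum X n w = partial_sum X k w.
Proof.
move=> n1; rewrite /max_partial_sum big_nat_cond.
apply: (big_ind (fun v => exists2 k, (k <= n)%N & v = partial_sum X k w)).
- by exists 1%N.
- by move=> v1 v2 H1 H2; case: leP.
- by move=> k /andP[/andP[_ kn] _]; exists k.
Qed.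

Lemma partial_sum_le_max (X : nat -> T -> R) (n : nat) w : (1 <= n)%N ->
  partial_sum X n w <= max_partial_sum X n w.
Proof.
by move=> n1; apply: (@le_bigmax_seq _ _ _ _ _ n) => //; rewrite mem_index_iota n1 ltnS leqnn.
Qed.

Lemma measurable_max_partial_sum (X : nat -> T -> R) (n : nat) :
  (forall i, measurable_fun setT (X i.+1)) ->
  measurable_fun setT (max_partial_sum X n).
Proof.
move=> mX.
have mS k : measurable_fun setT (partial_sum X k).
  rewrite (_ : partial_sum X k = fun w => \sum_(i < k) X i.+1 w); last first.
    by apply/funext => w; rewrite partial_sum_ord.
  by apply: measurable_sum => i; exact: mX.
rewrite /max_partial_sum; elim: (index_iota 1 n.+1) => [|k r IH].
  by under eq_fun do rewrite big_nil; exact: mS.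
by under eq_fun do rewrite big_cons; exact: measurable_maxr.
Qed.

(** If the sums reach 4 n z, then those of one of the two compensated parts reach
    2 n z. For lam = z / u^2 the exponent - lam (2 n z) + n (lam u)^2 of the bounded
    part equals - n z^2 / u^2. *)
Lemma maximal_tail_bound (F : nat -> set (set T)) (xi : nat -> T -> R)
    (C1 p u z : R) (n : nat) :
  0 < C1 -> 0 < p -> 0 < u -> 0 < z -> (1 <= n)%N ->
  filtration F ->
  (forall i, measurable_wrt (F i.+1) (xi i)) ->
  (forall i, P.-integrable setT (EFin \o xi i)) ->
  (forall i A, F i A -> \int[P]_(x in A) xi i x <= 0) ->
  (forall i, \int[P]_x (expR (`|xi i x| `^ p))%:E <= C1%:E)%E ->
  (P [set w | exists2 k, (k <= n)%N & (n%:R * (4 * z) <= \sum_(i < k) xi i w)%R] <=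
   (expR (- (n%:R * z ^+ 2 / u ^+ 2)) + n%:R *
     (C1 * (u ^+ 2 + (2 / p) `^ (2 / p)) * expR (- (u `^ p))) / (n%:R * (2 * z)) ^+ 2)%:E)%E.
Proof.
move=> C10 p0 u0 z0 n1 fF mxi ixi drift expm.
have [sF mF _] := fF.
have mxiT i : measurable_fun setT (xi i).
  exact: (measurable_wrt_measurable (@mF i.+1)).
have /choice[c cP] : forall i, exists c : (T -> R) * (T -> R),
  [/\ measurable_wrt (F i) c.1, forall x, `|c.1 x| <= u,
      P.-integrable setT (EFin \o c.2) &
  [/\ forall A, F i A -> \int[P]_(x in A) (trunc_at u (xi i) x + c.1 x) <= 0,
      forall A, F i A -> \int[P]_(x in A) (xi i x - trunc_at u (xi i) x - c.1 x) <= 0,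
      forall A, F i A -> \int[P]_(x in A) (xi i x - trunc_at u (xi i) x - c.2 x) = 0 &
      forall x, c.1 x ^+ 2 <= c.1 x * c.2 x]].
  move=> i; have [Vh [V H]] := truncation_compensator (sF i) (@mF i) u0 (ixi i) (drift i).
  by exists (Vh, V).
pose t i := trunc_at u (xi i).
pose v i := (c i).1.
pose Z i x := xi i x - t i x - v i x.
pose tl i x := xi i x - t i x.
pose K := (u ^+ 2 + (2 / p) `^ (2 / p)) * expR (- (u `^ p)).
have K0 : 0 <= K by rewrite mulr_ge0 ?expR_ge0// addr_ge0 ?sqr_ge0 ?powR_ge0.
pose e i x := expR (`|xi i x| `^ p).
have me i : measurable_fun setT (e i).
  apply: measurableT_comp => //; apply: (@measurableT_comp _ _ _ _ _ _ (fun r => r `^ p)).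
    exact: measurable_powR.
  exact: measurableT_comp.
have mt i : measurable_fun setT (t i) by exact: measurable_trunc_at.
have mtl i : measurable_fun setT (tl i) by exact: measurable_funB.
have tle i x : tl i x ^+ 2 <= K * e i x.
  rewrite /tl /t /trunc_at; case: ifPn => [_|].
    by rewrite subrr expr0n/= mulr_ge0// expR_ge0.
  rewrite -ltNge subr0 => ux; rewrite -(real_normK (num_real _)).
  by apply: sqr_le_powR_expR => //; exact: ltW.
have ie i : P.-integrable setT (EFin \o e i).
  apply/integrableP; split; first exact/measurable_EFinP.
  under eq_integral => x _ do rewrite gee0_abs ?lee_fin ?expR_ge0//.
  exact: le_lt_trans (expm i) (ltry _).
have itl2 i : P.-integrable setT (EFin \o (fun x => tl i x ^+ 2)).
  have iKe : P.-integrable setT (EFin \o (fun x => K * e i x)).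
    by have := integrableZl measurableT K (ie i).
  apply: le_integrable iKe => //.
    by apply/measurable_EFinP; exact: measurable_funX.
  move=> x _ /=; rewrite lee_fin ger0_norm ?sqr_ge0// ger0_norm//.
  exact: le_trans (sqr_ge0 _) (tle i x).
have tl2le i : \int[P]_x tl i x ^+ 2 <= C1 * K.
  apply: (@le_trans _ _ (\int[P]_x (K * e i x))).
    apply: le_Rintegral => //.
    by have := integrableZl measurableT K (ie i).
  rewrite RintegralZl// mulrC ler_wpM2r//.
  rewrite /Rintegral -[leRHS]/(fine C1%:E) fine_le//; last exact: expm.
  exact: integrable_fin_num (ie i).
pose g i x := tl i x - (c i).2 x.
have it i : P.-integrable setT (EFin \o t i).
  by apply: (@bounded_integrable _ _ _ _ _ u) => // x; exact: trunc_at_le (ltW u0).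
have itl i : P.-integrable setT (EFin \o tl i).
  by have := integrableB measurableT (ixi i) (it i).
have ig i : P.-integrable setT (EFin \o g i).
  by have [_ _ iV _] := cP i; have := integrableB measurableT (itl i) iV.
have mv i : measurable_fun setT (v i).
  by have [mv _ _ _] := cP i; exact: (measurable_wrt_measurable (@mF i)).
have vu i x : `|v i x| <= u by have [_ h _ _] := cP i; exact: h.
have ivg i : P.-integrable setT (EFin \o (fun x => v i x * g i x)).
  by apply: (integrable_bounded_mul (B := u)).
(* q i dominates the square of Z i because the compensator v i lies between 0 and
   (c i).2; its second term has integral 0 over the events of F i. *)
pose q i x := tl i x ^+ 2 - 2 * (v i x * g i x).
have i2vg i : P.-integrable setT (EFin \o (fun x => 2 * (v i x * g i x))).
  by have := integrableZl measurableT 2 (ivg i).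
have iq i : P.-integrable setT (EFin \o q i).
  by have := integrableB measurableT (itl2 i) (i2vg i).
have Zq i x : Z i x ^+ 2 <= q i x.
  have [_ _ _ [_ _ _ vV]] := cP i; have := vV x; rewrite -/(v i) /q /g /Z -/(tl i x).
  nra.
have mtF i : measurable_wrt (F i.+1) (t i).
  have mg : measurable_fun setT (fun r : R => if `|r| <= u then r else 0).
    by apply: measurable_fun_ifT => //; apply: measurable_fun_ler.
  exact: (measurable_wrt_comp fF mg (mxi i)).
have mvF i : measurable_wrt (F i) (v i) by have [] := cP i.
have mZF i : measurable_wrt (F i.+1) (Z i).
  apply/(measurable_wrtP (sF _)); apply: measurable_funB.
    by apply: measurable_funB; exact/(measurable_wrtP (sF _)).
  by apply/(measurable_wrtP (sF _)); exact: measurable_wrt_le (mvF i).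
have iZ i : P.-integrable setT (EFin \o Z i).
  have iv : P.-integrable setT (EFin \o v i) by exact: (@bounded_integrable _ _ _ _ _ u).
  by have := integrableB measurableT (itl i) iv.
have qc i A : F i A -> \int[P]_(x in A) q i x <= C1 * K.
  move=> FA; have mA := mF i _ FA.
  have on h : P.-integrable setT (EFin \o h) -> P.-integrable A (EFin \o h) by exact: integrable_on.
  rewrite /q RintegralB//; [|exact: on..].
  rewrite RintegralZl//; last exact: on.
  have [_ _ _ [_ _ gd _]] := cP i.
  rewrite (Rintegral_mul_eq0 (sF i) (@mF i) (ig i) gd (mvF i) (vu i) FA) mulr0 subr0.
  apply: le_trans (tl2le i).
  rewrite [leLHS]Rintegral_mkcond; apply: le_Rintegral => //.
    rewrite -restrict_EFin.
    by apply/(integrable_mkcond _ mA); exact: on.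
  by move=> x _; rewrite /patch; case: ifP => // _; exact: sqr_ge0.
pose lam := z / u ^+ 2.
have azuma := @supermartingale_azuma _ _ _ P F fF t v u lam (n%:R * (2 * z)) n u0
  (divr_ge0 (ltW z0) (sqr_ge0 _)) mtF mvF (fun i x => trunc_at_le (xi i) x (ltW u0)) vu
  (fun i A => let: And4 _ _ _ (And4 h _ _ _) := cP i in h A).
have nz0 : 0 < n%:R * (2 * z) by rewrite mulr_gt0 ?mulr_gt0 ?ltr0n.
have kolm := @supermartingale_kolmogorov _ _ _ P F fF Z q (C1 * K) (n%:R * (2 * z)) n nz0 mZF iZ
  (fun i A => let: And4 _ _ _ (And4 _ h _ _) := cP i in h A) iq Zq qc.
have mev (f : nat -> T -> R) y : (forall i, measurable_fun setT (f i)) ->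
    measurable [set w | exists2 k : nat, (k <= n)%N & y <= \sum_(i < k) f i w].
  move=> mf; apply: (@measurable_some_ge _ _ _ (fun k w => \sum_(i < k) f i w)) => k.
  by apply: measurable_sum => i; exact: mf.
set A1 := [set w | _] in azuma; set A2 := [set w | _] in kolm.
have mA1 : measurable A1.
  by apply: (@mev (fun i x => t i x + v i x)) => i; exact: measurable_funD.
have mA2 : measurable A2.
  by apply: mev => i; exact: (measurable_wrt_measurable (@mF i.+1)).
apply: (@le_trans _ _ (P (A1 `|` A2))).
  apply: le_measure; rewrite ?inE.
  - exact: mev.
  - exact: measurableU.
  - move=> w [k kn H].
    have [h1|h1] := lerP (n%:R * (2 * z)) (\sum_(i < k) (t i w + v i w)).
      by left; exists k.
    right; exists k => //.
    have : \sum_(i < k) xi i w = \sum_(i < k) (t i w + v i w) + \sum_(i < k) Z i w.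
      by rewrite -big_split/=; apply: eq_bigr => i _; rewrite /Z; ring.
    by move=> E; rewrite E in H; lra.
apply: (le_trans (measureU2 _ mA1 mA2)).
rewrite EFinD; apply: leeD; last by rewrite -[C1 * _ * expR _]mulrA.
apply: le_trans azuma _; rewrite lee_fin ler_expR le_eqVlt; apply/orP; left; apply/eqP.
by rewrite /lam; field; apply/eqP; lra.
Qed.
End UpperBound.

(** * Moderate deviations of coin tossing *)

Section CoinTossing.
Context {R : realType}.
Implicit Types (n : nat) (t theta : R).

Definition coin_sign (b : bool) : R := if b then 1 else -1.

Definition coin_sum n (e : {ffun 'I_n -> bool}) : R := \sum_(i < n) coin_sign (e i).

Lemma coin_mgf n theta : \sum_(e : {ffun 'I_n -> bool}) expR (theta * coin_sum e) =
  (expR theta + expR (- theta)) ^+ n.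
Proof.
rewrite (_ : expR theta + expR (- theta) =
    \sum_(b : bool) expR (theta * coin_sign b)); last first.
  by rewrite big_bool /= mulr1 mulrN1.
rewrite -[n in RHS]card_ord -prodr_const bigA_distr_bigA/=; apply: eq_bigr => e _.
by rewrite /coin_sum mulr_sumr expR_sum.
Qed.

(** The values of the walk are sorted into three ranges. Between n t and n s the factor
    exp(th0 S) is at most exp(th0 n s). Below n t it is compared with the smaller
    tilt th1, and above n s with the larger tilt th2. *)
Lemma coin_tail_mgf n (t s th0 th1 th2 : R) : 0 <= th0 -> th1 <= th0 -> th0 <= th2 ->
  (expR th0 + expR (- th0)) ^+ n <=
  expR (th0 * (n%:R * s)) * #|[pred e : {ffun 'I_n -> bool} | n%:R * t <= coin_sum e]|%:R
  + expR ((th0 - th1) * (n%:R * t)) * (expR th1 + expR (- th1)) ^+ n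
  + expR (- ((th2 - th0) * (n%:R * s))) * (expR th2 + expR (- th2)) ^+ n.
Proof.
move=> th00 th10 th02.
rewrite -!coin_mgf.
have -> : #|[pred e : {ffun 'I_n -> bool} | n%:R * t <= coin_sum e]|%:R =
    \sum_(e : {ffun 'I_n -> bool}) (n%:R * t <= coin_sum e)%R%:R :> R.
  rewrite -sum1_card natr_sum big_mkcond; apply: eq_bigr => e _.
  by rewrite inE; case: (_ <= _).
rewrite !mulr_sumr -!big_split/=; apply: ler_sum => e _.
set S := coin_sum e; rewrite -!expRD.
have E0 (z : R) : 0 <= expR z by exact: expR_ge0.
have [tS|St] := lerP (n%:R * t) S; last first.
  rewrite mulr0 add0r; apply: ler_wpDr => //.
  rewrite ler_expR; nra.
have [Ss|sS] := lerP S (n%:R * s).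
  rewrite mulr1 -addrA; apply: ler_wpDr; first exact: addr_ge0.
  by rewrite ler_expR ler_wpM2l.
rewrite mulr1; apply: ler_wpDl; first exact: addr_ge0.
rewrite ler_expR; nra.
Qed.

(** Put N = n t^2. The tilt 4t/3 has moment generating function at least
    exp(31 N / 36), whereas each of the outer ranges, with the tilts t and 5t/3 that
    are optimal for the cuts t and s = 5t/3, contributes at most exp(30 N / 36). The
    middle range is divided by exp(20 N / 9), and 20/9 - 31/36 = 49/36. *)
Lemma coin_tail_lower n t : 0 < t -> t ^+ 2 <= 9 / 248 ->
  4 <= expR (n%:R * t ^+ 2 / 36) ->
  expR (- (49 / 36 * (n%:R * t ^+ 2))) / 2 <=
  #|[pred e : {ffun 'I_n -> bool} | n%:R * t <= coin_sum e]|%:R / 2 ^+ n.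
Proof.
move=> t0 t2; set N := n%:R * t ^+ 2 => N4.
have := @coin_tail_mgf n t (5 / 3 * t) (4 / 3 * t) t (5 / 3 * t).
set E := #|_|%:R; set c := fun x : R => (expR x + expR (- x)) / 2.
have cE x : expR x + expR (- x) = 2 * c x by rewrite /c; field.
have ce x : (expR x + expR (- x)) ^+ n = 2 ^+ n * c x ^+ n by rewrite cE exprMn.
rewrite !ce => H.
have {}H := H ltac:(lra) ltac:(lra) ltac:(lra).
have p2 : 0 < 2 ^+ n :> R by rewrite exprn_gt0.
have c0 x : 0 <= c x by rewrite /c divr_ge0// addr_ge0 ?expR_ge0.
have cup x : c x ^+ n <= expR (n%:R * (x ^+ 2 / 2)).
  by rewrite expRM_natl lerXn2r ?nnegrE ?expR_ge0//; exact: cosh_le_expR_half_sqr.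
have clow : expR (31 / 36 * N) <= c (4 / 3 * t) ^+ n.
  rewrite (_ : 31 / 36 * N = n%:R * (31 / 64 * (4 / 3 * t) ^+ 2)); last by rewrite /N; field.
  rewrite expRM_natl lerXn2r ?nnegrE ?expR_ge0//; apply: cosh_ge_expR.
  by rewrite exprMn; lra.
have {}H : c (4 / 3 * t) ^+ n <= expR (20 / 9 * N) * (E / 2 ^+ n)
    + expR (5 / 6 * N) + expR (5 / 6 * N).
  have h1 : expR ((4 / 3 * t - t) * (n%:R * t)) * c t ^+ n <= expR (5 / 6 * N).
    rewrite (_ : 5 / 6 * N = (4 / 3 * t - t) * (n%:R * t) + n%:R * (t ^+ 2 / 2)); last first.
      by rewrite /N; field.
    by rewrite expRD ler_wpM2l ?expR_ge0.
  have h2 : expR (- ((5 / 3 * t - 4 / 3 * t) * (n%:R * (5 / 3 * t)))) * c (5 / 3 * t) ^+ n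
      <= expR (5 / 6 * N).
    rewrite (_ : 5 / 6 * N = - ((5 / 3 * t - 4 / 3 * t) * (n%:R * (5 / 3 * t))) +
       n%:R * ((5 / 3 * t) ^+ 2 / 2)); last by rewrite /N; field.
    by rewrite expRD ler_wpM2l ?expR_ge0.
  have e0 : 4 / 3 * t * (n%:R * (5 / 3 * t)) = 20 / 9 * N by rewrite /N; field.
  rewrite e0 in H.
  rewrite -(ler_pM2l p2); apply: (le_trans H).
  rewrite (_ : 2 ^+ n * (expR (20 / 9 * N) * (E / 2 ^+ n) + expR (5 / 6 * N) + expR (5 / 6 * N)) =
    expR (20 / 9 * N) * E + 2 ^+ n * expR (5 / 6 * N) + 2 ^+ n * expR (5 / 6 * N)); last first.
    by field; apply/eqP; lra.
  by rewrite !lerD// mulrCA ler_wpM2l// ltW.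
have e1 : expR (31 / 36 * N) = expR (N / 36) * expR (5 / 6 * N).
  by rewrite -expRD; congr expR; field.
have e2 : expR (- (49 / 36 * N)) * expR (20 / 9 * N) = expR (31 / 36 * N).
  by rewrite -expRD; congr expR; field.
have e3 : 0 < expR (20 / 9 * N) by exact: expR_gt0.
rewrite -(ler_pM2r e3) mulrAC e2.
have e4 : 0 < expR (5 / 6 * N) by exact: expR_gt0.
rewrite [leRHS]mulrC.
have : 4 * expR (5 / 6 * N) <= expR (31 / 36 * N) by rewrite e1 ler_wpM2r// ltW.
lra.
Qed.

End CoinTossing.

(** * Binary digits and the space of coin sequences *)

Section Digits.
Context {R : realType}.
Implicit Types (u : R) (s : seq bool).

Definition doubling u : R := if u < 1 / 2 then 2 * u else 2 * u - 1.

Definition digit u i : bool := 1 / 2 <= iter i doubling u.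

(** The number in [0, 1[ with binary expansion s. *)
Fixpoint dyadic s : R := if s is b :: s' then (b%:R + dyadic s') / 2 else 0.

Lemma digitS u i : digit u i.+1 = digit (doubling u) i.
Proof. by rewrite /digit iterSr. Qed.

Lemma dyadic_bounds s : 0 <= dyadic s /\ dyadic s + 2 ^- size s <= 1.
Proof.
elim: s => [|b s [IH1 IH2]] /=; first by rewrite expr0 invr1 add0r.
rewrite exprS invfM; set e := 2 ^- size s in IH2 *.
by case: b; rewrite /= ?mulr1n ?mulr0n; split; lra.
Qed.

(** The doubling map sends the half of [0, 1[ selected by the first digit affinely onto
    [0, 1[. *)
Lemma digits_dyadic s u : 0 <= u < 1 ->
  (forall i, (i < size s)%N -> digit u i = nth false s i) <->
  dyadic s <= u < dyadic s + 2 ^- size s.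
Proof.
elim: s u => [|b s IH] u u01 /=; first by rewrite expr0 invr1 add0r.
have /andP[u0 u1] := u01.
have d01 : 0 <= doubling u < 1.
  by rewrite /doubling; case: ltP => h; apply/andP; split; lra.
have split_digit : (forall i, (i < (size s).+1)%N -> digit u i = nth false (b :: s) i) <->
  digit u 0 = b /\ (forall i, (i < size s)%N -> digit (doubling u) i = nth false s i).
  split=> [h|[h0 h] [//|i] /h].
    by split=> [|i si]; [exact: (h 0%N)|rewrite -digitS; exact: (h i.+1)].
  by rewrite digitS.
rewrite split_digit; have {split_digit} -> := IH _ d01.
have [d0 d1] := dyadic_bounds s.
have s0 : 0 < 2 ^- size s :> R by rewrite invr_gt0 exprn_gt0.
rewrite exprS invfM /digit/= /doubling; move: s0 d0 d1.
set e := 2 ^- size s; set a := dyadic s => s0 d0 d1.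
case: b; rewrite /= ?mulr1n ?mulr0n; case: (ltP u (1 / 2)) => h; split.
- by case=> h'; lra.
- by move=> /andP[? ?]; lra.
- by move=> [_ /andP[? ?]]; apply/andP; split; lra.
- by move=> /andP[? ?]; split=> //; apply/andP; split; lra.
- by move=> [_ /andP[? ?]]; apply/andP; split; lra.
- by move=> /andP[? ?]; split=> //; apply/andP; split; lra.
- by case=> h'; lra.
- by move=> /andP[? ?]; lra.
Qed.

Lemma dyadic_gt0 s : true \in s -> 0 < dyadic s.
Proof.
elim: s => // b s IH; rewrite inE /= => /predU1P[<-|/IH h].
  by have [h _] := dyadic_bounds s; rewrite mulr1n; lra.
by case: b; rewrite /= ?mulr1n ?mulr0n; lra.
Qed.

Lemma digit_exists u : 0 < u < 1 -> exists i, digit u i.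
Proof.
move=> /andP[u0 u1]; apply/not_existsP => h.
have [k hk] : exists k : nat, u^-1 < k%:R by exists (Num.truncn u^-1).+1; exact: truncnS_gt.
have nth0 i : nth false (nseq k false) i = false by rewrite nth_nseq; case: ifP.
have dy0 : dyadic (nseq k false) = 0 by elim: k {hk nth0} => //= k ->; rewrite add0r mul0r.
have /(digits_dyadic (nseq k false)) [H _] : 0 <= u < 1 by rewrite ltW.
have := H (fun i _ => etrans (negbTE (introN idP (h i))) (esym (nth0 i))).
rewrite dy0 add0r size_nseq => /andP[_]; apply/negP; rewrite -leNgt.
rewrite -[leRHS]invrK lef_pV2 ?posrE ?exprn_gt0 ?invr_gt0//.
by rewrite (le_trans (ltW hk))// -natrX ler_nat ltnW// ltn_expl.
Qed.
End Digits.

(** The index of the scale and the sequence of coins. *)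
Definition coin_point := (nat * (nat -> bool))%type.
HB.instance Definition _ := Pointed.on coin_point.

Definition cylinder (w : coin_point) (n : nat) : set coin_point :=
  [set w' | w'.1 = w.1 /\ forall i, (i < n)%N -> w'.2 i = w.2 i].

(** The empty set is included for stability under intersection. *)
Definition cylinders : set (set coin_point) :=
  [set A | A = set0 \/ exists w n, A = cylinder w n].

Definition coin_space := g_sigma_algebraType cylinders.
HB.instance Definition _ := Measurable.on coin_space.

Lemma measurable_cylinder (w : coin_point) n : measurable (cylinder w n : set coin_space).
Proof. by apply: sub_sigma_algebra; right; exists w, n. Qed.

Lemma cylinders_setI : setI_closed cylinders.
Proof.
have meet w n w' n' : (n <= n')%N ->
    cylinders (cylinder w n `&` cylinder w' n').
  move=> nn'; have [[w1 w2]|ww'] := pselect (cylinder w n w').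
    right; exists w', n'; apply/seteqP; split=> [x []//|x [x1 x2]].
    split; split=> // [|i ni]; first by rewrite x1.
    by rewrite x2 ?w2//; exact: leq_trans nn'.
  left; apply/seteqP; split=> // x [[x1 x2] [x1' x2']]; apply: ww'.
  split=> [|i ni]; first by rewrite -x1'.
  by rewrite -x2' ?x2//; exact: leq_trans nn'.
move=> A B [->|[w [n ->]]]; first by rewrite set0I; left.
move=> [->|[w' [n' ->]]]; first by rewrite setI0; left.
have [/meet//|/ltnW/meet] := leqP n n'.
by rewrite setIC.
Qed.

Section CoinMeasure.
Context {R : realType}.

Lemma coin_measure_unique (P Q : probability coin_space R) :
  (forall w n, P (cylinder w n) = Q (cylinder w n)) ->
  forall A : set coin_space, measurable A -> P A = Q A.
Proof.
move=> PQ A mA.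
apply: (@g_sigma_algebra_measure_unique _ R coin_space cylinders _
  (fun k => cylinder (k, fun=> false) 0)) => //.
- by move=> B HB; exact: sub_sigma_algebra.
- by move=> k; right; exists (k, fun=> false), 0%N.
- by apply/seteqP; split=> // x _; exists x.1.
- exact: cylinders_setI.
- by move=> B [->|[w [n ->]]]; [rewrite !measure0|exact: PQ].
- move=> k; apply: (@le_lt_trans _ _ 1%E); last exact: ltry.
  by apply: probability_le1; exact: measurable_cylinder.
Qed.

Definition first_digit (u : R) : nat :=
  if pselect (exists i, digit u i) is left h then ex_minn h else 0%N.

(** The place of the first digit 1 is a geometric variable, independent of the fair
    digits that follow. The points outside ]0, 1[, a null set for the measure of
    [coin_measure_exists], get a default value. *)
Definition coin_of (u : R) : coin_space :=
  if 0 < u < 1 then (first_digit u, fun i => digit u ((first_digit u).+1 + i)%N)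
  else (0%N, fun=> false).

(** The digits of u that force [coin_of] u into the cylinder. *)
Definition cylinder_word (w : coin_point) n : seq bool :=
  nseq w.1 false ++ true :: mkseq w.2 n.

Lemma size_cylinder_word w n : size (cylinder_word w n) = (w.1 + n).+1.
Proof. by rewrite size_cat size_nseq/= size_mkseq addnS. Qed.

Lemma coin_of_cylinder (u : R) w n : 0 < u < 1 ->
  cylinder w n (coin_of u) <->
  dyadic (cylinder_word w n) <= u < dyadic (cylinder_word w n) + 2 ^- (w.1 + n).+1.
Proof.
move=> u01; have [i0 hi0] := digit_exists u01.
rewrite -(size_cylinder_word w n) -digits_dyadic; last first.
  by case/andP: u01 => u0 ->; rewrite ltW.
rewrite size_cylinder_word /coin_of u01 /cylinder/= /first_digit.
case: pselect => [h|]; last by move=> h; exfalso; apply: h; exists i0.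
case: ex_minnP => m dm mmin; split.
  move=> [mE hn] i; rewrite ltnS /cylinder_word nth_cat size_nseq => ilt.
  case: ltnP => [im|mi].
    rewrite nth_nseq im; apply/negbTE/negP => /mmin.
    by rewrite mE leqNgt im.
  move: mi; rewrite leq_eqVlt => /predU1P[<-|mi]; first by rewrite subnn -mE.
  have -> : i = (w.1.+1 + (i - w.1.+1))%N by rewrite subnKC.
  rewrite addSn -addnS addKn/= nth_mkseq; last by rewrite ltn_subLR// addSn ltnS.
  by rewrite -hn ?mE ?addSnnS// ltn_subLR// addSn ltnS.
move=> H.
have wm : digit u w.1.
  rewrite H ?ltnS ?leq_addr// /cylinder_word nth_cat size_nseq ltnn subnn//.
have mw : m = w.1.
  apply/eqP; rewrite eqn_leq mmin//= leqNgt; apply/negP => mlt.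
  have := H m; rewrite ltnS (leq_trans (ltnW mlt)) ?leq_addr// => /(_ isT).
  by rewrite dm /cylinder_word nth_cat size_nseq mlt nth_nseq mlt.
split=> // i ni; rewrite mw H; last by rewrite addSn ltnS ltn_add2l.
rewrite /cylinder_word nth_cat size_nseq ltnNge addSn (leq_trans (leq_addr i w.1)) ?leqnSn//=.
by rewrite -addnS addKn/= nth_mkseq.
Qed.

Lemma coin_of_preimage w n :
  coin_of @^-1` (cylinder w n) `&` `]0, 1[%classic =
  `[dyadic (cylinder_word w n), dyadic (cylinder_word w n) + 2 ^- (w.1 + n).+1[%classic.
Proof.
have [d0 d1] := @dyadic_bounds R (cylinder_word w n).
have dpos : 0 < dyadic (cylinder_word w n) :> R.
  by apply: dyadic_gt0; rewrite mem_cat inE eqxx orbT.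
rewrite size_cylinder_word in d1.
apply/seteqP; split=> u /=; rewrite !in_itv/=.
  by move=> [h u01]; move/(coin_of_cylinder w n u01): h.
move=> h; have u01 : 0 < u < 1.
  by case/andP: h => h1 h2; rewrite (lt_le_trans dpos)//= (lt_le_trans h2).
by split=> //; apply/coin_of_cylinder.
Qed.

Lemma measurable_coin_of : measurable_fun setT coin_of.
Proof.
apply: (@measurability _ _ R coin_space setT coin_of cylinders) => //.
move=> _ [B [->|[w [n ->]]] <-].
  by rewrite setTI preimage_set0.
rewrite setTI (_ : coin_of @^-1` _ =
    (coin_of @^-1` (cylinder w n) `&` `]0, 1[%classic) `|`
    (coin_of @^-1` (cylinder w n) `&` ~` `]0, 1[%classic)); last first.
  by rewrite -setIUr setUv setIT.
rewrite coin_of_preimage; apply: measurableU; first exact: measurable_itv.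
have [w0|w0] := pselect (cylinder w n (0%N, fun=> false)).
  rewrite (_ : _ `&` _ = ~` `]0, 1[%classic); first by apply: measurableC; exact: measurable_itv.
  apply/seteqP; split=> u /=; [by case|rewrite in_itv/= => u01; split=> //].
  by rewrite /coin_of; case: ifPn u01 => // ->.
rewrite (_ : _ `&` _ = set0)//; apply/seteqP; split=> // u /= [+].
by rewrite in_itv/= /coin_of; case: ifPn => // _ h _; exact: w0.
Qed.

(** A cylinder is pulled back to a dyadic interval, whose length is known. *)
Lemma coin_measure_exists : exists P : probability coin_space R,
  forall w n, P (cylinder w n) = (2 ^- (w.1 + n).+1)%:E.
Proof.
pose mu := mrestr (@lebesgue_measure R) (measurable_itv `]0%R, 1%R[).
have mu1 : mu setT = 1%E.
  by rewrite /mu /mrestr setTI lebesgue_measure_itv/= lte_fin ltr01 -EFinB subr0.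
pose P0 : probability (measurableTypeR R) R :=
  HB.pack mu (Measure_isProbability.Build _ _ _ mu mu1).
have mcoin : @measurable_fun _ _ (measurableTypeR R) coin_space setT coin_of.
  exact: measurable_coin_of.
pose phi : {mfun (measurableTypeR R) >-> coin_space} := HB.pack coin_of
  (isMeasurableFun.Build _ _ _ _ _ mcoin).
exists (distribution P0 phi) => w n.
rewrite /distribution/= /pushforward /mu /mrestr coin_of_preimage.
rewrite lebesgue_measure_itv/= lte_fin ltrDl invr_gt0 exprn_gt0//.
by rewrite -EFinB addrAC subrr add0r.
Qed.
End CoinMeasure.

(** * Invariance of the coin measure *)

Section CoinDynamics.
Context {R : realType}.
Variable P : probability coin_space R.
Hypothesis PE : forall w n, P (cylinder w n) = (2 ^- (w.1 + n).+1)%:E.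

Definition determined (n : nat) : set (set coin_space) :=
  [set A | forall w w' : coin_space, w.1 = w'.1 ->
     (forall j, (j < n)%N -> w.2 j = w'.2 j) -> A w -> A w'].

Definition extend_word (m n : nat) (e : {ffun 'I_n -> bool}) : coin_space :=
  (m, fun j => if insub j is Some i then e i else false).

Lemma extend_wordE m n (e : {ffun 'I_n -> bool}) (i : 'I_n) :
  (extend_word m e).2 i = e i.
Proof. by rewrite /extend_word/= valK. Qed.

(** There are countably many cylinders with n coins, and A is a union of such. *)
Lemma determined_measurable n (A : set coin_space) : determined n A -> measurable A.
Proof.
move=> dA.
rewrite (_ : A = \bigcup_m \bigcup_(e in [set e : {ffun 'I_n -> bool} | A (extend_word m e)])
  cylinder (extend_word m e) n).
  apply: bigcupT_measurable => m; apply: fin_bigcup_measurable => // e _.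
  exact: measurable_cylinder.
apply/seteqP; split=> [w Aw|w [m _ [e Ae [we1 we2]]]].
  exists w.1 => //; exists [ffun i : 'I_n => w.2 i].
    apply: dA Aw => // j jn.
    by rewrite (extend_wordE _ _ (Ordinal jn)) ffunE.
  split=> // i ni.
  by rewrite (extend_wordE _ _ (Ordinal ni)) ffunE.
by apply: dA Ae => // j jn; rewrite we2.
Qed.

Lemma filtration_determined : filtration determined.
Proof.
split=> [n|n A|n A dA w w' w1 w2].
- split=> [w w' _ _ //|A dA w w' w1 w2 /= [_ nA]|F dF w w' w1 w2 [k _ Fk]].
    split=> // Aw'; apply: nA; apply: dA Aw' => // j jn; exact/esym/w2.
  by exists k => //; exact: dF Fk.
- exact: determined_measurable.
- by apply: dA => // j jn; apply: w2; exact: leqW.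
Qed.

Lemma coin_measure_preserving (g : coin_space -> coin_space) :
  (forall w n, measurable (g @^-1` (cylinder w n))) ->
  (forall w n, P (g @^-1` (cylinder w n)) = P (cylinder w n)) ->
  measurable_fun setT g /\ forall A, measurable A -> P (g @^-1` A) = P A.
Proof.
move=> mg gE.
have mgT : measurable_fun setT g.
  apply: (@measurability _ _ coin_space coin_space setT g cylinders) => //.
  move=> _ [B [->|[w [n ->]]] <-]; rewrite setTI ?preimage_set0//; exact: mg.
split=> // A mA.
pose phi : {mfun coin_space >-> coin_space} := HB.pack g
  (isMeasurableFun.Build _ _ _ _ _ mgT).
by apply: (@coin_measure_unique R (distribution P phi) P).
Qed.

Definition flip (i : nat) (w : coin_space) : coin_space :=
  (w.1, fun j => if j == i then ~~ w.2 j else w.2 j).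

Lemma flip_cylinder i w n : flip i @^-1` (cylinder w n) = cylinder (flip i w) n.
Proof.
apply/seteqP; split=> x [x1 x2]; split=> // j jn; have /= := x2 j jn.
  by case: eqP => // _ <-; rewrite negbK.
by case: eqP => // _ ->; rewrite negbK.
Qed.

Lemma flip_preserving i :
  measurable_fun setT (flip i) /\ forall A, measurable A -> P (flip i @^-1` A) = P A.
Proof.
by apply: coin_measure_preserving => w n; rewrite flip_cylinder ?PE//;
  exact: measurable_cylinder.
Qed.

Definition shift_coins (w : coin_space) : coin_space := (w.1, fun j => w.2 j.+1).

Definition cons_coin (b : bool) (w : coin_space) : coin_space :=
  (w.1, fun j => if j is k.+1 then w.2 k else b).

(** The coin that the shift forgets can have either value. *)
Lemma shift_cylinder w n : shift_coins @^-1` (cylinder w n) =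
  cylinder (cons_coin true w) n.+1 `|` cylinder (cons_coin false w) n.+1.
Proof.
apply/seteqP; split=> [x [x1 x2]|x [] [x1 x2]].
- case x0 : (x.2 0%N); [left|right]; split=> // -[|j] //; rewrite ltnS => /x2 //.
- by split=> // j jn; exact: (x2 j.+1).
- by split=> // j jn; exact: (x2 j.+1).
Qed.

Lemma shift_preserving :
  measurable_fun setT shift_coins /\
  forall A, measurable A -> P (shift_coins @^-1` A) = P A.
Proof.
apply: coin_measure_preserving => w n; rewrite shift_cylinder.
  by apply: measurableU; exact: measurable_cylinder.
rewrite measureU; [|exact: measurable_cylinder|exact: measurable_cylinder|].
  rewrite [X in (X + _)%E]PE [X in (_ + X)%E]PE PE/= -EFinD; congr EFin.
  rewrite addnS ![in LHS](exprS _ (w.1 + n).+1) invfM.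
  by set x := 2 ^- _; lra.
apply/seteqP; split=> // x [[_ /(_ 0%N isT) x1] [_ /(_ 0%N isT)]].
by rewrite x1.
Qed.

Lemma coin_count_measure m n (E : pred {ffun 'I_n -> bool}) :
  P (\bigcup_(e in [set e | E e]) cylinder (extend_word m e) n) =
  (2 ^- m.+1 * (#|E|%:R / 2 ^+ n))%:E.
Proof.
have dis : trivIset [set e | E e] (fun e => cylinder (extend_word m e) n).
  move=> e e' _ _ [w [[_ w1] [_ w2]]]; apply/ffunP => i.
  by rewrite -(extend_wordE m e i) -(extend_wordE m e' i) -w1 ?w2.
rewrite measure_fin_bigcup//=; last by move=> e _; exact: measurable_cylinder.
rewrite -(bigfs _ (r := index_enum _) (P := E))/=; last 2 first.
- exact: index_enum_uniq.
- by move=> e _; rewrite mem_index_enum.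
under eq_bigr => e _ do rewrite PE/=.
rewrite sumEFin sumr_const -mulr_natr; congr EFin.
by rewrite -addSn exprD invfM; ring.
Qed.
End CoinDynamics.

(** * The extremal martingale *)

Section Extremal.
Context {R : realType}.
Variables (alpha : R).
Hypotheses (alpha0 : 0 < alpha) (alpha1 : alpha < 1).
Variable P : probability coin_space R.
Hypothesis PE : forall w n, P (cylinder w n) = (2 ^- (w.1 + n).+1)%:E.

Local Notation p := (2 * alpha / (1 - alpha)).

Let p0 : 0 < p. Proof. by apply: divr_gt0; [apply: mulr_gt0|rewrite subr_gt0]. Qed.

(** With this choice exp(step_scale m ^ p) = 2^(2m/3), which is integrable for the
    geometric law of m, whereas the scale exceeds y with probability of order
    exp(- 3/2 y^p). *)
Definition step_scale (m : nat) : R := (2 / 3 * ln 2 * m%:R) `^ (p^-1).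

Lemma step_scale_powR m : step_scale m `^ p = 2 / 3 * ln 2 * m%:R.
Proof.
rewrite /step_scale -powRrM mulVf ?gt_eqF// powRr1// mulr_ge0// mulr_ge0//.
by apply: ln_ge0; lra.
Qed.

Definition coin_walk_step (i : nat) (w : coin_space) : R :=
  step_scale w.1 * coin_sign (w.2 i.-1).

Local Notation X := coin_walk_step.

Lemma step_scale_ge0 m : 0 <= step_scale m. Proof. exact: powR_ge0. Qed.

Lemma coin_walk_step_norm i w : `|X i w| = step_scale w.1.
Proof.
rewrite /X normrM (ger0_norm (step_scale_ge0 _)) /coin_sign.
by case: (w.2 _); rewrite ?normrN normr1 mulr1.
Qed.

Lemma determined_step i B : (1 <= i)%N -> determined i (X i @^-1` B).
Proof.
by case: i => // i _ w w' w1 w2 /=; rewrite /X/= w1 w2.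
Qed.

Lemma measurable_step i : (1 <= i)%N -> measurable_fun setT (X i).
Proof.
move=> i1 _ B mB; rewrite setTI; apply: (@determined_measurable i).
exact: determined_step.
Qed.

(** The events that fix the scale index split the integral into a geometric series of
    ratio 2^(2/3) / 2. *)
Lemma step_exp_moment i : (1 <= i)%N ->
  (\int[P]_w (expR (`|X i w| `^ p))%:E < +oo)%E.
Proof.
move=> i1.
pose r : R := expR (2 / 3 * ln 2) / 2.
have r0 : 0 < r by rewrite divr_gt0// expR_gt0.
have r1 : r < 1.
  rewrite ltr_pdivrMr// mul1r -[ltRHS](lnK (x := 2)) ?posrE// ltr_expR.
  by have : 0 < ln (2 : R); [rewrite ln_gt0//; lra|lra].
pose C m := cylinder (m, fun=> false) 0.
have mC m : measurable (C m : set coin_space) by exact: measurable_cylinder.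
have CT : \bigcup_m C m = setT by apply/seteqP; split=> // w _; exists w.1.
have mf : measurable_fun setT (fun w => (expR (`|X i w| `^ p))%:E).
  apply/measurable_EFinP; apply: measurableT_comp => //.
  apply: (@measurableT_comp _ _ _ _ _ _ (fun r => r `^ p)); first exact: measurable_powR.
  apply: measurableT_comp => //; exact: measurable_step.
rewrite -CT ge0_integral_bigcup//; last 2 first.
- by rewrite CT.
- by move=> m m' _ _ [w [[/= <- _] [/= <- _]]].
have term m : (\int[P]_(w in C m) (expR (`|X i w| `^ p))%:E = (geometric (1/2) r m)%:E)%E.
  under eq_integral => w.
    rewrite inE => -[wm _]; rewrite coin_walk_step_norm wm step_scale_powR.
    over.
  rewrite integral_cst//= PE/= addn0 -EFinM; congr EFin.
  rewrite /geometric/= /r exprMn -expRM_natr exprS invfM exprVn; ring.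
under eq_eseriesr => m _ do rewrite term.
apply: (@le_lt_trans _ _ ((1/2) * (1 - r)^-1)%:E); last exact: ltry.
apply: lime_le.
  by apply: is_cvg_nneseries => n _ _; rewrite lee_fin geometric_ge0// ltW.
apply: nearW => n; rewrite sumEFin lee_fin.
apply: geometric_le_lim => //; rewrite gtr0_norm//.
Qed.

(** Dominated by the exponential moment, as y <= y^2 <= K exp(y^p) for y >= 1. *)
Lemma integrable_step i : (1 <= i)%N -> P.-integrable setT (EFin \o X i).
Proof.
move=> i1.
pose K : R := 1 + (1 ^+ 2 + (2 / p) `^ (2 / p)) * expR (- (1 `^ p)).
have ie : P.-integrable setT (EFin \o (fun w => expR (`|X i w| `^ p))).
  apply/integrableP; split.
    apply/measurable_EFinP; apply: measurableT_comp => //.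
    apply: (@measurableT_comp _ _ _ _ _ _ (fun r => r `^ p)); first exact: measurable_powR.
    apply: measurableT_comp => //; exact: measurable_step.
  under eq_integral => x _ do rewrite gee0_abs ?lee_fin ?expR_ge0//.
  exact: step_exp_moment.
have iKe : P.-integrable setT (EFin \o (fun w => K * expR (`|X i w| `^ p))).
  by have := integrableZl measurableT K ie.
apply: le_integrable iKe => //.
  by apply/measurable_EFinP; exact: measurable_step.
move=> w _ /=; rewrite lee_fin [leRHS]ger0_norm; last first.
  by rewrite mulr_ge0 ?expR_ge0// /K addr_ge0// mulr_ge0 ?expR_ge0// addr_ge0 ?powR_ge0.
set y := `|X i w|; have E0 : 1 <= expR (y `^ p) by rewrite -expR0 ler_expR powR_ge0.
have [y1|y1] := lerP y 1.
  rewrite (le_trans y1)// (le_trans E0)// ler_peMl ?expR_ge0// /K lerDl.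
  by rewrite mulr_ge0 ?expR_ge0// addr_ge0 ?powR_ge0.
have := sqr_le_powR_expR p0 (ltr01 : 0 < 1 :> R) (ltW y1).
have yy : y <= y ^+ 2 by rewrite expr2 ler_peMr// ?normr_ge0// ltW.
move=> /(le_trans yy)/le_trans; apply.
by rewrite ler_wpM2r ?expR_ge0// /K lerDr.
Qed.

(** Coins are numbered from 0 and increments from 1. The flip of coin i preserves the
    measure and the events of time i, and changes the sign of the increment i + 1,
    whose integral over such an event is thus equal to its opposite. *)
Lemma coin_walk_mds : martingale_differences P determined X.
Proof.
split; first exact: filtration_determined.
  by move=> i i1; split; [move=> B _; exact: determined_step|exact: integrable_step].
case=> // i _; exists (cst 0); split; last by apply: aeW.
split.
- move=> B mB w w' _ _ //.
- exact: integrable0.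
move=> A dA; rewrite integral0.
have mA : measurable A by exact: determined_measurable dA.
have [mfl flE] := flip_preserving PE i.
pose phi : {mfun coin_space >-> coin_space} := HB.pack (flip i)
  (isMeasurableFun.Build _ _ _ _ _ mfl).
have iX := integrable_step (ltn0Sn i).
have mX : measurable_fun setT (EFin \o X i.+1) by exact: measurable_int iX.
have iXA : P.-integrable A (EFin \o X i.+1) by exact: integrableS iX.
have AE : flip i @^-1` A = A.
  apply/seteqP; split=> w /=; apply: dA => //= j; case: eqP => // ->.
  by rewrite ltnn.
  by rewrite ltnn.
have XE : (EFin \o X i.+1) \o flip i = (\- (EFin \o X i.+1))%E.
  apply/funext => w /=; rewrite /X/= eqxx /coin_sign.
  by case: (w.2 i); rewrite /= ?mulrN1 ?opprK ?mulr1.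
have : (\int[P]_(w in A) (X i.+1 w)%:E = - \int[P]_(w in A) (X i.+1 w)%:E)%E.
  rewrite -[RHS]integralN/=; last exact: integrable_add_def.
  rewrite [LHS](eq_measure_integral (distribution P phi)); last first.
    by move=> B mB _; apply/esym; exact: (flE B mB).
  have iXA' : P.-integrable (flip i @^-1` A) ((EFin \o X i.+1) \o flip i).
    by rewrite AE XE; exact: integrableN.
  by rewrite (integral_pushforward mfl mX iXA' mA) AE XE.
have := integrable_fin_num mA iXA.
case: (\int[P]_(x in A) _)%E => //= z _ [] zz; congr EFin; lra.
Qed.

(** The increments with indices raised by one are the increments of the shifted
    sequence, and the shift preserves the measure. *)
Lemma coin_walk_stationary : stationary P X.
Proof.
move=> m k B _; rewrite /pushforward.
pose S := (fun w => [tuple X i.+1 w | i < m]) @^-1` B.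
have dS : determined m S.
  move=> w w' w1 w2; rewrite /S/=; congr (B _).
  apply: eq_mktuple => i; by rewrite /X/= w1 w2.
have mS : measurable S by exact: determined_measurable dS.
elim: k => [|k IH].
  by under eq_fun do under eq_mktuple do rewrite addn0.
have [msh shE] := shift_preserving PE.
rewrite -IH.
pose Sk := (fun w => [tuple X (i.+1 + k)%N w | i < m]) @^-1` B.
have dSk : determined (m + k) Sk.
  move=> w w' w1 w2; rewrite /Sk/=; congr (B _).
  apply: eq_mktuple => i; rewrite /X/= w1 w2//.
  by rewrite ltn_add2r.
rewrite -(shE _ (determined_measurable dSk)); congr (P _).
apply/seteqP; split => w; rewrite /Sk/=; congr (B _); apply: eq_mktuple => i;
  by rewrite /X/= addnS.
Qed.

Lemma coin_walk_partial_sum n m (e : {ffun 'I_n -> bool}) w :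
  cylinder (extend_word m e) n w -> partial_sum X n w = step_scale m * coin_sum e.
Proof.
move=> [w1 w2]; rewrite partial_sum_ord /coin_sum mulr_sumr; apply: eq_bigr => i _.
by rewrite /X/= w1 w2// extend_wordE.
Qed.

(** With t = n^(- (1 - alpha)/2) one has n t^2 = n^alpha, and a walk of signs above n t
    is carried above n by a scale of at least 1/t. The index m is the first that
    grants such a scale, up to rounding; rounding costs a factor 4 and
    [coin_tail_lower] a factor 2. The threshold 144 is large enough to absorb the
    factor 8 in the exponential, and 28 makes t small enough for [coin_tail_lower]. *)
Lemma coin_walk_max_lower n : 144 <= n%:R `^ alpha :> R -> 28 <= n%:R `^ (1 - alpha) :> R ->
  ((expR (- (3 * n%:R `^ alpha)))%:E
     <= P [set w | (n%:R <= max_partial_sum X n w)%R])%E.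
Proof.
move=> N144 n28; set N := n%:R `^ alpha in N144 *.
have N8 : 8 <= 1 + 5 / 36 * N by lra.
have n0 : 0 < n%:R :> R.
  rewrite ltr0n lt0n; apply/eqP => n0; move: N144.
  by rewrite /N n0 powR0 ?gt_eqF//; lra.
have n1 : (1 <= n)%N by rewrite -(ltr0n R).
pose t : R := n%:R `^ (- ((1 - alpha) / 2)).
have t0 : 0 < t by exact: powR_gt0.
have t2E : t ^+ 2 = (n%:R `^ (1 - alpha))^-1.
  rewrite /t -powRN -powR_mulrn ?powR_ge0// -powRrM; congr (_ `^ _); by field.
have NE : n%:R * t ^+ 2 = N.
  rewrite t2E -powRN -[X in X * _]powRr1 ?(ltW n0)// -powRD; last first.
    by rewrite (gt_eqF n0) implybT.
  by rewrite /N; congr (_ `^ _); ring.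
have l2 : 0 < ln (2 : R) by rewrite ln_gt0//; lra.
pose m := (Num.truncn (3 / 2 * N / ln 2)).+1.
have m1 : 3 / 2 * N / ln 2 <= m%:R by exact: ltW (truncnS_gt _).
have m2 : m%:R <= 3 / 2 * N / ln 2 + 1.
  rewrite /m -natr1 lerD2r; rewrite truncn_le; apply: divr_ge0; [lra|exact: ltW].
have scalem : t^-1 <= step_scale m.
  have -> : t^-1 = N `^ (p^-1).
    rewrite /t -powRN opprK /N -powRrM; congr (_ `^ _); field; rewrite subr_eq0 !gt_eqF //.
  rewrite /step_scale ge0_ler_powR ?nnegrE ?invr_ge0 ?(ltW p0)//.
  - exact: powR_ge0.
  - by rewrite mulr_ge0// mulr_ge0// ltW.
  move: m1; rewrite ler_pdivrMr// => m1; lra.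
pose E := [pred e : {ffun 'I_n -> bool} | n%:R * t <= coin_sum e :> R].
pose W := \bigcup_(e in [set e | E e]) cylinder (extend_word m e) n.
apply: (@le_trans _ _ (P W)); last first.
  apply: le_measure; rewrite ?inE.
  - by apply: fin_bigcup_measurable => // e _; exact: measurable_cylinder.
  - apply: measurable_ge_set; apply: measurable_max_partial_sum => i.
    exact: measurable_step.
  - move=> w [e]; rewrite /E/= => eE we.
    apply: le_trans (partial_sum_le_max _ _ n1).
    rewrite (coin_walk_partial_sum we).
    apply: (@le_trans _ _ (t^-1 * coin_sum e)).
      by rewrite mulrC ler_pdivlMr.
    by rewrite ler_wpM2r// (le_trans _ eE)// mulr_ge0 ?(ltW n0)// ltW.
rewrite /W coin_count_measure// lee_fin.
have tail : expR (- (49 / 36 * N)) / 2 <= #|E|%:R / 2 ^+ n.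
  have := @coin_tail_lower R n t t0; rewrite NE; apply.
    rewrite t2E -[leRHS]invrK lef_pV2 ?posrE ?invr_gt0//; last exact: powR_gt0.
    by apply: le_trans n28; lra.
  by apply: le_trans (expR_ge1Dx _); lra.
have pm : expR (- (3 / 2 * N)) / 4 <= 2 ^- m.+1 :> R.
  have -> : (2 : R) ^- m.+1 = expR (- (m.+1%:R * ln 2)).
    by rewrite expRN expRM_natl lnK ?posrE.
  have -> : expR (- (3 / 2 * N)) / 4 = expR (- (3 / 2 * N) - 2 * ln 2).
    rewrite expRD; congr (_ * _); rewrite expRN mulrC expRM_natr lnK ?posrE//.
    by congr (_ ^-1); ring.
  rewrite ler_expR -natr1.
  have : m%:R * ln 2 <= (3 / 2 * N / ln 2 + 1) * ln 2 by rewrite ler_pM2r.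
  by rewrite mulrDl divfK ?gt_eqF//; lra.
have prod : expR (- (3 / 2 * N)) / 4 * (expR (- (49 / 36 * N)) / 2) <=
    2 ^- m.+1 * (#|E|%:R / 2 ^+ n).
  by apply: ler_pM => //; rewrite divr_ge0// expR_ge0.
apply: le_trans prod.
have -> : expR (- (3 / 2 * N)) / 4 * (expR (- (49 / 36 * N)) / 2) =
   expR (- (3 * N)) * (expR (5 / 36 * N) / 8).
  have -> : expR (- (3 * N)) * (expR (5 / 36 * N) / 8) =
     expR (- (3 * N)) * expR (5 / 36 * N) / 8 by rewrite mulrA.
  rewrite -expRD (_ : - (3 * N) + 5 / 36 * N = - (3 / 2 * N) - 49 / 36 * N); last by field.
  by rewrite expRD; field.
rewrite ler_peMr ?expR_ge0// ler_pdivlMr// mul1r.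
exact: le_trans N8 (expR_ge1Dx _).
Qed.

Lemma near_powR_ge (b c : R) : 0 < b -> 0 < c -> \forall n \near \oo, c <= n%:R `^ b.
Proof.
move=> b0 c0; have := nbhs_infty_ger (c `^ b^-1); apply: filterS => n cn.
have -> : c = (c `^ b^-1) `^ b by rewrite -powRrM mulVf ?gt_eqF// powRr1// ltW.
by rewrite ge0_ler_powR ?nnegrE ?powR_ge0 ?(ltW b0).
Qed.

End Extremal.

(** * The two bounds and the extremal example *)

Section Assembly.
Context {R : realType}.

Lemma supermartingale_max_tail (alpha : R) d (T : measurableType d)
    (P : probability T R) (F : nat -> set (set T)) (X : nat -> T -> R) (C1 x : R) (n : nat) :
  0 < alpha -> alpha < 1 -> 0 < C1 ->
  supermartingale_differences P F X ->
  (forall i, (1 <= i)%N ->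
    'E_P[fun w => expR (`|X i w| `^ (2 * alpha / (1 - alpha)))] <= C1%:E)%E ->
  0 < x -> (1 <= n)%N ->
  (P [set w | (n%:R * x <= max_partial_sum X n w)%R]
   <= (bound_const C1 alpha x
       * expR (- ((x / 4) `^ (2 * alpha) * n%:R `^ alpha)))%:E)%E.
Proof.
move=> alpha0 alpha1 C10 supX expX x0 n1.
have [fF adX _] := supX.
have mX i : measurable_wrt (F i.+1) (X i.+1) by case: (adX i.+1 isT).
have iX i : P.-integrable setT (EFin \o X i.+1) by case: (adX i.+1 isT).
have mXT i : measurable_fun setT (X i.+1).
  by apply/measurable_EFinP; exact: measurable_int (iX i).
have p0 : 0 < 2 * alpha / (1 - alpha).
  by apply: divr_gt0; [apply: mulr_gt0|rewrite subr_gt0].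
have n0 : 0 < n%:R :> R by rewrite ltr0n.
have z0 : 0 < x / 4 by rewrite divr_gt0.
have u0 := trunc_level_gt0 alpha z0 n0.
set u := trunc_level alpha (x / 4) n%:R in u0.
have := @maximal_tail_bound _ _ _ P F (fun i => X i.+1) C1 _ u _ n C10 p0 u0 z0 n1 fF mX iX
  (fun i A => supermartingale_drift supX).
rewrite (_ : 4 * (x / 4) = x); last by field.
rewrite /u trunc_level_rate// trunc_level_powR// -/u.
set s := (x / 4) `^ (2 * alpha) * _ => H.
apply: (@le_trans _ _ (P [set w | exists2 k : nat, (k <= n)%N &
    n%:R * x <= \sum_(i < k) X i.+1 w])).
  apply: le_measure; rewrite ?inE.
  - by apply: measurable_ge_set; exact: measurable_max_partial_sum.
  - by apply: measurable_some_ge => k; exact: measurable_sum.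
  - move=> w /=; have [k kn ->] := max_partial_sum_attained X w n1.
    by rewrite partial_sum_ord; exists k.
apply: (le_trans (H _)) => [i|].
  by have := expX i.+1 isT; rewrite unlock.
rewrite lee_fin; have := @bound_const_ge _ alpha x n%:R C1 alpha0 alpha1 x0 _ C10.
rewrite ler1n n1 -/u => /(_ isT) /(ler_wpM2r (expR_ge0 (- s))); apply: le_trans.
rewrite le_eqVlt; apply/orP; left; apply/eqP.
set b := _ `^ _; set q := (n%:R * (2 * (x / 4))) ^+ 2; ring.
Qed.

Lemma supermartingale_max_bigO (alpha : R) d (T : measurableType d)
    (P : probability T R) (F : nat -> set (set T)) (X : nat -> T -> R) (C1 : R) :
  0 < alpha -> alpha < 1 -> 0 < C1 ->
  supermartingale_differences P F X ->
  (forall i, (1 <= i)%N ->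
    'E_P[fun w => expR (`|X i w| `^ (2 * alpha / (1 - alpha)))] <= C1%:E)%E ->
  is_bigO (fun n => fine (P [set w | n%:R <= max_partial_sum X n w]))
          (fun n => expR (- (1 / 16 * n%:R `^ alpha))).
Proof.
move=> alpha0 alpha1 C10 supX expX.
have [_ adX _] := supX.
have mX i : measurable_fun setT (X i.+1).
  by have [_ iX] := adX i.+1 isT; apply/measurable_EFinP; exact: measurable_int iX.
have C0 : 0 < bound_const C1 alpha 1.
  rewrite /bound_const ltr_pwDl// mulr_ge0 ?mulr_ge0 ?(ltW C10)//.
  by rewrite addr_ge0// mulr_ge0 ?divr_ge0 ?mulr_ge0 ?powR_ge0 ?sqr_ge0.
exists (bound_const C1 alpha 1); split=> // n n1.
have mE : measurable [set w | n%:R <= max_partial_sum X n w].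
  by apply: measurable_ge_set; exact: measurable_max_partial_sum.
have := supermartingale_max_tail alpha0 alpha1 C10 supX expX ltr01 n1.
rewrite mulr1 => H.
rewrite ger0_norm ?fine_ge0// ger0_norm ?expR_ge0//.
rewrite -lee_fin fineK ?fin_num_measure//; apply: (le_trans H).
rewrite lee_fin ler_wpM2l ?(ltW C0)// ler_expR lerN2 ler_wpM2r ?powR_ge0//.
rewrite (_ : 1 / 16 = (1 / 4) `^ 2); last by rewrite powR_mulrn//; field.
by apply: ger_powR; lra.
Qed.

Lemma coin_walk_extremal (alpha : R) : 0 < alpha -> alpha < 1 ->
  exists (P : probability coin_space R),
    [/\ martingale_differences P determined (coin_walk_step alpha),
        stationary P (coin_walk_step alpha),
        ('E_P[fun w => expR (`|coin_walk_step alpha 1 w| `^ (2 * alpha / (1 - alpha)))]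
         < +oo)%E &
        \forall n \near \oo,
          ((expR (- (3 * n%:R `^ alpha)))%:E
           <= P [set w | (n%:R <= max_partial_sum (coin_walk_step alpha) n w)%R])%E].
Proof.
move=> alpha0 alpha1; have [P PE] := @coin_measure_exists R.
exists P; split.
- exact: coin_walk_mds.
- exact: coin_walk_stationary.
- by rewrite unlock; exact: step_exp_moment.
have N144 : 0 < (144 : R) by [].
have n28 : 0 < (28 : R) by [].
have near1 := near_powR_ge alpha0 N144.
have b1 : 0 < 1 - alpha by rewrite subr_gt0.
have near2 := near_powR_ge b1 n28.
by apply: filterS2 near1 near2 => n; exact: coin_walk_max_lower.
Qed.
End Assembly.

Unset Implicit Arguments.

Theorem theorem2p1 (R : realType) (alpha : R)
    (halpha0 : 0 < alpha) (halpha1 : alpha < 1) :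
  (forall (d : measure_display) (T : measurableType d) (P : probability T R)
      (F : nat -> set (set T)) (X : nat -> T -> R) (C1 : R),
    0 < C1 ->
    supermartingale_differences P F X ->
    (ereal_sup [set 'E_P[fun w =>
                      expR (`|X i w| `^ (2 * alpha / (1 - alpha)))]
               | i in [set i : nat | (1 <= i)%N]] <= C1%:E)%E ->
    (forall (x : R) (n : nat), 0 < x -> (1 <= n)%N ->
      (P [set w | (n%:R * x <= max_partial_sum X n w)%R]
       <= (bound_const C1 alpha x
           * expR (- ((x / 4) `^ (2 * alpha) * n%:R `^ alpha)))%:E)%E)
    /\
    is_bigO (fun n => fine (P [set w | n%:R <= max_partial_sum X n w]))
            (fun n => expR (- (1 / 16 * n%:R `^ alpha))))
  /\
  (exists (d : measure_display) (T : measurableType d) (P : probability T R)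
      (F : nat -> set (set T)) (X : nat -> T -> R),
    [/\ martingale_differences P F X,
        stationary P X,
        ('E_P[fun w => expR (`|X 1%N w| `^ (2 * alpha / (1 - alpha)))]
         < +oo)%E &
        \forall n \near \oo,
          ((expR (- (3 * n%:R `^ alpha)))%:E
           <= P [set w | (n%:R <= max_partial_sum X n w)%R])%E]).
Proof.
split.
  move=> d T P F X C1 C10 supX expX.
  have expX' i : (1 <= i)%N ->
      ('E_P[fun w => expR (`|X i w| `^ (2 * alpha / (1 - alpha)))] <= C1%:E)%E.
    by move=> i1; apply: le_trans expX; apply: ereal_sup_ubound; exists i.
  split=> [x n x0 n1|].
    exact: (supermartingale_max_tail halpha0 halpha1 C10 supX expX' x0 n1).
  exact: (supermartingale_max_bigO halpha0 halpha1 C10 supX expX').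
have [P H] := coin_walk_extremal halpha0 halpha1.
by exists _, coin_space, P, determined, (coin_walk_step alpha).
Qed.
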